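(* Let ${\bf V}$ be an $N\times L$ random Vandermonde matrix whose phases are i.i.d. with law $\nu$, where $\nu$ is absolutely continuous on $[-\pi,\pi]$ with density $p\in\mathcal{L}\cap\mathcal{A}$. Let $\{{\bf D}_r(N)\}_{1\le r\le n}$ be non-random diagonal $L\times L$ matrices having a joint limit distribution as $N\to\infty$. Then, when $L/N\to c$, the limit $$M_n=\lim_{N\to\infty}\mathbb{E}\Big[\mathrm{tr}_L\big({\bf D}_1(N){\bf V}^*{\bf V}{\bf D}_2(N){\bf V}^*{\bf V}\cdots{\bf D}_n(N){\bf V}^*{\bf V}\big)\Big]$$ exists and equals $\sum_{\rho\in\mathcal{P}(n)}K_{\rho,\nu}\,c^{|\rho|-1}D_\rho$.
   Context: ${\bf V}=N^{-1/2}(e^{-j(k-1)\theta_l})_{k\le N,l\le L}$. $\mathrm{tr}_L=\frac1L\mathrm{Tr}$. $\mathcal{L}=\bigcap_{q\ge1}L^q([-\pi,\pi])$; $\mathcal{A}$: densities with all Fourier coefficients $\int e^{-imt}p(t)dt\ge 0$. The family has a joint limit distribution if $D_{i_1,\dots,i_s}:=\lim_{N}\mathrm{tr}_L({\bf D}_{i_1}(N)\cdots{\bf D}_{i_s}(N))$ exists for all choices $i_1,\dots,i_s\in\{1,\dots,n\}$. $\mathcal{P}(n)$ is the set of partitions of $\{1,\dots,n\}$, $|\rho|$ the number of blocks; for $\rho=\{B_1,\dots,B_r\}$ with $B_j=\{i_{j1},\dots,i_{j|B_j|}\}$, $D_\rho:=\prod_{j=1}^rD_{i_{j1},\dots,i_{j|B_j|}}$.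 With $a_\nu(m)=\int e^{imx}d\nu(x)$, $i_0:=i_n$, $E_b(\mathbf{i})=\sum_{k\in B_b}(i_{k-1}-i_k)$ for $\mathbf{i}\in\{1,\dots,N\}^n$, the expansion coefficient is $K_{\rho,\nu}:=\lim_N N^{r-n-1}\sum_{\mathbf{i}\in\{1,\dots,N\}^n}\prod_{b=1}^r a_\nu(E_b(\mathbf{i}))$. *)

(* Defs.v *)
From HB Require Import structures.
From mathcomp Require Import all_boot all_order all_algebra.
From mathcomp Require Import all_classical all_reals all_analysis.
From mathcomp Require Import complex.
Set Implicit Arguments. Unset Strict Implicit. Unset Printing Implicit Defensive.
Import Order.TTheory GRing.Theory Num.Theory.
Import numFieldNormedType.Exports.
Local Open Scope classical_set_scope.
Local Open Scope ring_scope.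
Local Open Scope complex_scope.

Section Defs.
Variable R : realType.
Local Notation C := R[i].

Definition ccvg (u : nat -> C) (z : C) : Prop :=
  (fun N => complex.Re (u N)) @ \oo --> complex.Re z /\ (fun N => complex.Im (u N)) @ \oo --> complex.Im z.

Definition Ipi : set R := `[(- pi)%R, pi]%classic.

Definition expj (x : R) : C := cos x +i* sin x.

Definition vandermonde (N L : nat) (theta : 'I_L -> R) : 'M[C]_(N, L) :=
  \matrix_(k < N, l < L) ((Num.sqrt (N%:R : R))^-1%:C * expj (- (k%:R * theta l))).

Definition adjmx m n (A : 'M[C]_(m, n)) : 'M[C]_(n, m) := (map_mx conjc A)^T.

Definition trL L (A : 'M[C]_L) : C := (L%:R)^-1 * \tr A.

Definition mixed_product n N L (d : 'I_n -> 'rV[C]_L) (theta : 'I_L -> R) : 'M[C]_L :=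
  let G := adjmx (vandermonde N theta) *m vandermonde N theta in
  foldr (fun r A => diag_mx (d r) *m G *m A) 1%:M (enum 'I_n).

Definition word_product n L (d : 'I_n -> 'rV[C]_L) (w : seq 'I_n) : 'M[C]_L :=
  foldr (fun r A => diag_mx (d r) *m A) 1%:M w.

Definition cexpect dT (T : measurableType dT) (P : probability T R) (X : T -> C) : C :=
  Rintegral P setT (fun w => complex.Re (X w)) +i* Rintegral P setT (fun w => complex.Im (X w)).

Definition mutually_independent dT (T : measurableType dT) (P : probability T R)
    L (X : 'I_L -> T -> R) : Prop :=
  forall A : 'I_L -> set R, (forall l, measurable (A l)) ->
    P (\bigcap_(l in [set: 'I_L]) (X l @^-1` A l)) = (\prod_(l < L) P (X l @^-1` A l))%E.

Definition has_density_on_pi dT (T : measurableType dT) (P : probability T R)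
    (Y : T -> R) (p : R -> R) : Prop :=
  forall A : set R, measurable A ->
    P (Y @^-1` A) = (\int[lebesgue_measure]_(x in A `&` Ipi) (p x)%:E)%E.

Definition in_all_Lq (p : R -> R) : Prop :=
  measurable_fun Ipi p /\
  forall q : nat, (1 <= q)%N ->
    (\int[lebesgue_measure]_(x in Ipi) (`|p x| ^+ q)%:E < +oo)%E.

(* p in A: all Fourier coefficients int e^{-imt} p(t) dt are (real) nonnegative *)
Definition fourier_nonneg (p : R -> R) : Prop :=
  forall m : int,
    Rintegral lebesgue_measure Ipi (fun t => sin (m%:~R * t) * p t) = 0 /\
    0 <= Rintegral lebesgue_measure Ipi (fun t => cos (m%:~R * t) * p t).

Definition a_nu (p : R -> R) (m : int) : C :=
  Rintegral lebesgue_measure Ipi (fun x => cos (m%:~R * x) * p x) +i*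
  Rintegral lebesgue_measure Ipi (fun x => sin (m%:~R * x) * p x).

(* E_b(i) = sum_{k in B} (i_{k-1} - i_k), with i_0 := i_n (0-indexed: i_{-1} := i_{n-1}) *)
Definition E_block n N (B : {set 'I_n}) (i : {ffun 'I_n -> 'I_N}) : int :=
  \sum_(k in B) ((i (ord_pred k))%:Z - (i k)%:Z).

(* the N-th term of the sequence whose limit is K_{rho,nu} *)
Definition K_term (p : R -> R) n (rho : {set {set 'I_n}}) (N : nat) : C :=
  (N%:R : C) ^ ((#|rho|%:Z - n%:Z - 1)%R) *
  \sum_(i : {ffun 'I_n -> 'I_N}) \prod_(B in rho) a_nu p (E_block B i).

(* D_rho = prod_{blocks B} D_{B}, with Dl w the joint limit moment of the word w *)
Definition D_rho n (Dl : seq 'I_n -> C) (rho : {set {set 'I_n}}) : C :=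
  \prod_(B in rho) Dl (enum B).

End Defs.

(* Main.v *)
(* Expanding the trace over the column indices l and the row indices i, and taking
   expectations over the independent phases, groups the terms by the kernel rho of l:
   the i-sum becomes the N-th term of K_rho, and the l-sum, suitably normalised, tends
   to c^(|rho|-1) D_rho, by induction on |rho| (maps constant on the blocks of rho
   factorise over the blocks, and those with a strictly coarser kernel are negligible).

   Existence of K_rho: integer elimination along the cycle 1 -> 2 -> ... -> n
   parametrises i by the block values E and by n - |rho| + 1 free coordinates. For fixed
   E the normalised number of free coordinates keeping i in the cube converges, so by
   dominated convergence over E it is enough that sum_{E, sum E = 0} prod a(E_b) be
   finite. With a >= 0 and s the K-th Fourier partial sum of 2 pi p, positivity gives
   int s^(m+1) <= 2 pi int s^m p, and a Young inequality for m + 1 even bounds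
   int s^(m+1) by a multiple of int p^(m+1), uniformly in K. *)
Require Import Defs.
From HB Require Import structures.
From mathcomp Require Import all_boot all_order all_algebra.
From mathcomp Require Import all_classical all_reals all_analysis.
From mathcomp Require Import complex.
From mathcomp Require Import measurable_realfun ring lra zify.
Set Implicit Arguments. Unset Strict Implicit. Unset Printing Implicit Defensive.
Import Order.TTheory GRing.Theory Num.Theory.
Import numFieldNormedType.Exports.
Local Open Scope ring_scope.
Local Open Scope complex_scope.

(** Only the existence of the limits is claimed, so no volume is computed: the lattice densities at
    two scales are compared at the product scale. The block values add up to zero around the cycle,
    so the block of index 0 is dropped and [#|rho|.-1] independent values remain. The elimination
    has to be unimodular: an inverse with rational entries would impose congruences on the block
    values. Only the independent values are truncated at [K]; the coefficient of the dropped block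
    stays whole, which is why the truncated sum is [int s^m p] with [m = #|rho| - 1], and not
    [int s^(m+1)]. The obstacle is the sign of [s], a plain partial sum that may be negative: the
    Young inequality fails there when [m + 1] is odd. Since [int s^m p] increases with [m], every
    exponent is dominated by an odd one. Independence is given for events only, so the product rule
    for exponentials is obtained through simple functions. *)

Section UniformApproximation.
Local Open Scope classical_set_scope.
Variable R : realType.

(** The approximating sequence may change with [e]; only the Cauchy property is transferred, so no
    limit has to be named. *)
Lemma cvgn_unif_approx (a : nat -> R) :
  (forall e : R, 0 < e -> exists2 b : nat -> R, cvgn b &
     \forall N \near \oo, `|a N - b N| <= e) -> cvgn a.
Proof.
move=> H; apply/cauchy_cvgP/cauchy_ballP => e e0.
(* Three errors of size [e / 4] leave a strict inequality. *)
have e3 : 0 < e / 4 by rewrite divr_gt0.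
have [b cb ab] := H _ e3.
have /cauchy_cvgP/cauchy_ballP/(_ _ e3) bb := cb.
move: bb => -[[/= P Q]] [PN QN] PQ.
have PQN : \forall N \near \oo, P (b N) /\ Q (b N) /\ `|a N - b N| <= e / 4.
  have PN' : \forall N \near \oo, P (b N) := PN.
  have QN' : \forall N \near \oo, Q (b N) := QN.
  by near=> N; split; [|split]; near: N.
move: PQN => [n0 _ Hn0].
exists ([set a N | N in [set N | (n0 <= N)%N]], [set a N | N in [set N | (n0 <= N)%N]]).
  by split; exists n0 => // N /= ?; exists N.
move=> [_ _] /= [[m mn0 <-] [k kn0 <-]].
have [Pm [_ am]] := Hn0 _ mn0; have [_ [Qk ak]] := Hn0 _ kn0.
have := PQ (b m, b k) (conj Pm Qk); rewrite /ball /= => bmk.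
have -> : a m - a k = (a m - b m) + (b m - b k) + (b k - a k) by ring.
rewrite (le_lt_trans (ler_normD _ _))// (le_lt_trans (lerD (ler_normD _ _) (lexx _)))//.
rewrite [`|b k - a k|]distrC.
move: am ak bmk e0; move: `|a m - b m| `|a k - b k| `|b m - b k| => x y z; lra.
Unshelve. all: by end_near. Qed.

End UniformApproximation.

(** * Lattice points of a cube under integer affine constraints *)

Section LatticePoints.

Definition in_range (N : nat) (z : int) : bool := (0 <= z) && (z < N%:Z).

Definition linform n (T : 'M[int]_n) (s : 'I_n -> int) (N : nat)
    (y : {ffun 'I_n -> 'I_N}) (j : 'I_n) : int :=
  \sum_f T j f * (y f)%:Z + s j.

Definition lattice_count n (T : 'M[int]_n) (s : 'I_n -> int) (N : nat) : nat :=
  #|[set y : {ffun 'I_n -> 'I_N} | [forall j, in_range N (linform T s y j)]]|.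

(** Overwriting coordinate [f] of a solution by an arbitrary value loses nothing: the equation
    restores it, its coefficient being nonzero. *)
Lemma hyperplane_card n (T : 'M[int]_n) j f (A : nat) (v : int) : T j f != 0 ->
  (A * #|[set q : {ffun 'I_n -> 'I_A} | (\sum_g T j g * (q g)%:Z)%R == v]| <= A ^ n)%N.
Proof.
move=> Tjf.
set H := [set q | _].
pose F (aq : 'I_A * {ffun 'I_n -> 'I_A}) :=
  [ffun g => if g == f then aq.1 else aq.2 g] : {ffun 'I_n -> 'I_A}.
have Finj : {in finset.setX [set: 'I_A] H &, injective F}.
  move=> [a q] [a' q']; rewrite !finset.in_setX !finset.in_setT /= => Hq Hq' /ffunP FF.
  move: Hq Hq'; rewrite /H !finset.in_set => /eqP Hq /eqP Hq'.
  have aa : a = a' by have := FF f; rewrite !ffunE eqxx.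
  have qq g : g != f -> q g = q' g.
    by move=> gf; have := FF g; rewrite !ffunE (negbTE gf).
  have qf : q f = q' f.
    move: Hq; rewrite -Hq' (bigD1 f)//= [RHS](bigD1 f)//=.
    rewrite (eq_bigr (fun g => T j g * (q' g)%:Z)); last by move=> g gf; rewrite qq.
    move/addIr/(mulfI Tjf) => [] ?; exact/val_inj.
  rewrite aa; congr pair; apply/ffunP => g.
  by have [->|/qq] := eqVneq g f.
have := max_card (F @: finset.setX [set: 'I_A] H).
by rewrite (card_in_imset Finj) cardsX finset.cardsT card_ord card_ffun !card_ord.
Qed.


Lemma linform_mulD n (T : 'M[int]_n) s (A N : nat) (q : {ffun 'I_n -> 'I_A})
    (t : {ffun 'I_n -> 'I_N}) (y : {ffun 'I_n -> 'I_(A * N)}) j :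
  (forall f, nat_of_ord (y f) = (q f * N + t f)%N) ->
  linform T s y j = N%:Z * (\sum_f T j f * (q f)%:Z) + linform T s t j.
Proof.
move=> yE; rewrite /linform addrA mulr_sumr -big_split/=; congr (_ + _).
by apply: eq_bigr => f _; rewrite yE PoszD PoszM; ring.
Qed.

(** One constant for all rows and offsets. The successor makes [offset_le] strict, as the zero rows
    of [T] require. *)
Definition linbound n (T : 'M[int]_n) (s : 'I_n -> int) : nat :=
  (\sum_j (\sum_f `|T j f| + `|s j|)).+1%N.

Lemma linform_le n (T : 'M[int]_n) s (N : nat) (t : {ffun 'I_n -> 'I_N}) j :
  (0 < N)%N -> (`|linform T s t j| <= N * linbound T s)%N.
Proof.
move=> N0; rewrite /linform /linbound.
have H1 : (`|(\sum_f T j f * (t f)%:Z)%R| <= N * \sum_f `|T j f|)%N.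
  rewrite big_distrr/=; elim/big_ind2: _ => //.
    by move=> x1 x2 y1 y2 h1 h2; lia.
  by move=> f _; rewrite abszM mulnC leq_mul2r; apply/orP; right; exact: ltnW (ltn_ord (t f)).
have H2 : (\sum_f `|T j f| + `|s j| <= \sum_j (\sum_f `|T j f| + `|s j|))%N.
  by rewrite [leqRHS](bigD1 j)//= leq_addr.
move: H1 H2; set x := (\sum_f _ * _)%R; set a := (\sum_f _)%N; set b := (\sum_j _)%N.
nia.
Qed.

Lemma offset_le n (T : 'M[int]_n) s j : (`|s j| < linbound T s)%N.
Proof.
rewrite /linbound ltnS [leqRHS](bigD1 j)//=.
by rewrite -addnA addnCA leq_addr.
Qed.

(** These are the cells in which the position inside the cell could flip a constraint. Zero rows are
    left out, since they would put every cell on the boundary. *)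
Definition boundary n (T : 'M[int]_n) (s : 'I_n -> int) (A : nat)
    (q : {ffun 'I_n -> 'I_A}) : bool :=
  let x j := \sum_f T j f * (q f)%:Z in
  [exists j, [exists f, T j f != 0] &&
    ((`|x j| <= linbound T s)%N || (`|x j - A%:Z|%N <= linbound T s)%N)].

(* Away from the boundary the constraints on N q + t do not depend on t. *)
Lemma in_range_cell n (T : 'M[int]_n) s (A N : nat) (q : {ffun 'I_n -> 'I_A})
    (t : {ffun 'I_n -> 'I_N}) (y : {ffun 'I_n -> 'I_(A * N)}) :
  (forall f, nat_of_ord (y f) = (q f * N + t f)%N) ->
  (linbound T s <= A)%N -> (0 < N)%N -> ~~ boundary T s q ->
  [forall j, in_range (A * N) (linform T s y j)] =
  [forall j, in_range A (linform T s q j)].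
Proof.
move=> yE CA N0 /existsPn nb; apply: eq_forallb => j.
rewrite (linform_mulD T s j yE).
have := linform_le T s t j N0; have := offset_le T s j; have := nb j.
(* A zero row reduces to its offset, smaller than [A] in absolute value, so at both scales the
   constraint only says that it is nonnegative. *)
rewrite negb_and negb_exists negb_or; case: forallP => [T0 _|_ /=].
  have T0' f : T j f = 0 by apply/eqP; have := T0 f; rewrite negbK.
  have T0s K (z : {ffun 'I_n -> 'I_K}) : \sum_f T j f * (z f)%:Z = 0.
    by rewrite big1// => f _; rewrite T0' mul0r.
  rewrite /linform !T0s /in_range mulr0 !add0r.
  move: (s j) (linbound T s) CA => u C; nia.
rewrite /in_range [linform T s q j]/linform; move: (linform T s t j) (s j) (linbound T s) CA.
move: (\sum_f _) => x u v C CA /andP[]; rewrite -!ltnNge => h1 h2 h3 h4.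
have key (k : int) : 0 < k -> N%:Z <= N%:Z * k.
  by move=> k0; rewrite ler_peMr //; lia.
have uN : `|u| <= N%:Z * C%:Z by rewrite -abszE -PoszM lez_nat.
move/ler_normlP: uN => [uN1 uN2].
have [xC|xC] := lerP x (- C%:Z).
  have := key (- C%:Z - x); rewrite mulrBr mulrN.
  by move: (_ * x) (_ * C%:Z) uN1 uN2 => X Y; rewrite PoszM; lia.
have {}xC : C%:Z < x by lia.
have [xA|xA] := lerP (A%:Z + C%:Z) x.
  have := key (x - A%:Z - C%:Z); rewrite !mulrBr PoszM [A%:Z * _]mulrC.
  by move: (_ * x) (_ * C%:Z) (_ * A%:Z) uN1 uN2 => X Y Z; lia.
have {}xA : x < A%:Z - C%:Z by lia.
have := key (x - C%:Z); have := key (A%:Z - x - C%:Z).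
rewrite !mulrBr PoszM [A%:Z * _]mulrC.
by move: (_ * x) (_ * C%:Z) (_ * A%:Z) uN1 uN2 => X Y Z; lia.
Qed.

Lemma card_bigcup_le (I T : finType) (F : I -> {set T}) :
  (#|\bigcup_i F i| <= \sum_i #|F i|)%N.
Proof.
elim/big_ind2: _ => [|A a B b ha hb|//]; first by rewrite cards0.
by apply: leq_trans (leq_card_setU _ _) (leq_add ha hb).
Qed.

(** The boundary is covered by hyperplanes whose number does not depend on [A]: for each row,
    [C.*2.+1] integer levels around 0 and as many around [A]. *)
Lemma boundary_card n (T : 'M[int]_n) s : exists B : nat, forall A,
  (A * #|[set q : {ffun 'I_n -> 'I_A} | boundary T s q]| <= B * A ^ n)%N.
Proof.
set C := linbound T s.
exists (\sum_(j < n) \sum_(v < C.*2.+1) 2)%N => A.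
pose H j (v : int) := [set q : {ffun 'I_n -> 'I_A} | ([exists f, T j f != 0]) &&
   ((\sum_g T j g * (q g)%:Z)%R == v)].
have HC j v : (A * #|H j v| <= A ^ n)%N.
  have [/existsP[f Tf]|nT] := boolP [exists f, T j f != 0]; last first.
    rewrite (_ : H j v = finset.set0) ?cards0 ?muln0//.
    by apply/finset.setP => q; rewrite !inE (negbTE nT).
  apply: leq_trans (hyperplane_card A v Tf); rewrite leq_mul2l subset_leq_card ?orbT//.
  by apply/fintype.subsetP => q; rewrite !inE => /andP[].
have sub : [set q | boundary T s q] \subset
    \bigcup_(j < n) \bigcup_(v < C.*2.+1) (H j (v%:Z - C%:Z) :|: H j (A%:Z + v%:Z - C%:Z)).
  apply/fintype.subsetP => q; rewrite inE => /existsP[j /andP[Tj xj]].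
  apply/finset.bigcupP; exists j => //.
  case/orP: xj; set x := \sum_f _ => xj.
    have hv : (`|(x + C%:Z)%R|%N < C.*2.+1)%N by rewrite -/C in xj; lia.
    apply/finset.bigcupP; exists (Ordinal hv) => //; rewrite !inE Tj /= -/x.
    by apply/orP; left; apply/eqP; rewrite -/C in xj; lia.
  have hv : (`|(x - A%:Z + C%:Z)%R|%N < C.*2.+1)%N by rewrite -/C in xj; lia.
  apply/finset.bigcupP; exists (Ordinal hv) => //; rewrite !inE Tj /= -/x.
  by apply/orP; right; apply/eqP; rewrite -/C in xj; lia.
apply: (@leq_trans (A * \sum_(j < n) \sum_(v < C.*2.+1)
    (#|H j (v%:Z - C%:Z)%R| + #|H j (A%:Z + v%:Z - C%:Z)%R|))%N).
  rewrite leq_mul2l; apply/orP; right; apply: leq_trans (subset_leq_card sub) _.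
  apply: leq_trans (card_bigcup_le _) _; apply: leq_sum => j _.
  apply: leq_trans (card_bigcup_le _) _; apply: leq_sum => v _.
  exact: leq_card_setU.
rewrite big_distrr big_distrl; apply: leq_sum => j _ /=.
rewrite big_distrr big_distrl; apply: leq_sum => v _ /=.
by rewrite mulnDr mulSn mul1n leq_add.
Qed.

(** Writing coordinates as [q * N + t] cuts the large cube into cells indexed by [q]; off the
    boundary a cell contributes all of its [N ^ n] points or none. *)
Lemma lattice_count_refine n (T : 'M[int]_n) s (A N : nat) :
  (linbound T s <= A)%N -> (0 < N)%N ->
  let b := #|[set q : {ffun 'I_n -> 'I_A} | boundary T s q]| in
  (lattice_count T s (A * N) <= lattice_count T s A * N ^ n + b * N ^ n)%N /\
  (lattice_count T s A * N ^ n <= lattice_count T s (A * N) + b * N ^ n)%N.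
Proof.
move=> CA N0 b.
have lt_join (a : 'I_A) (c : 'I_N) : (a * N + c < A * N)%N.
  by move: (ltn_ord a) (ltn_ord c); nia.
pose join (qt : {ffun 'I_n -> 'I_A} * {ffun 'I_n -> 'I_N}) :=
  [ffun f => Ordinal (lt_join (qt.1 f) (qt.2 f))] : {ffun 'I_n -> 'I_(A * N)}.
have joinE q t f : nat_of_ord (join (q, t) f) = (q f * N + t f)%N by rewrite ffunE.
have join_inj : injective join.
  move=> [q t] [q' t'] /ffunP E.
  have {}E f : (q f * N + t f = q' f * N + t' f)%N.
    by have /(congr1 val) := E f; rewrite /= !ffunE.
  have Eq f : q f = q' f :> nat.
    by have := congr1 (divn^~ N) (E f); rewrite /= !divnMDl// !divn_small ?addn0.
  congr pair; apply/ffunP => f; apply/val_inj => /=; first exact: Eq.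
  by apply/eqP; have /eqP := E f; rewrite Eq eqn_add2l.
pose good K := [set y : {ffun 'I_n -> 'I_K} | [forall j, in_range K (linform T s y j)]].
pose bad := [set q : {ffun 'I_n -> 'I_A} | boundary T s q].
pose X := join @^-1: good (A * N)%N.
have cX : lattice_count T s (A * N) = #|X|.
  rewrite on_card_preimset//; apply: onW_bij; apply: inj_card_bij => //.
  by rewrite card_prod !card_ffun !card_ord expnMn.
have cP (S : {set {ffun 'I_n -> 'I_A}}) :
    #|finset.setX S [set: {ffun 'I_n -> 'I_N}]| = (#|S| * N ^ n)%N.
  by rewrite cardsX finset.cardsT card_ffun !card_ord.
have XE q t : q \notin bad -> ((q, t) \in X) = (q \in good A).
  by rewrite !inE => nb; rewrite (in_range_cell (joinE q t)).
rewrite cX -!cP; split; apply: leq_trans (leq_card_setU _ _);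
  apply: subset_leq_card; apply/fintype.subsetP => -[q t];
  rewrite !finset.in_setU !finset.in_setX !finset.in_setT !andbT;
  by have [//|/XE ->] := boolP (q \in bad); rewrite ?orbT ?orbF // => ->.
Qed.

End LatticePoints.

(** * Convergence of the lattice densities *)

Section LatticeLimit.
Local Open Scope classical_set_scope.
Variable R : realType.

Definition lattice_density n (T : 'M[int]_n) s (N : nat) : R :=
  (lattice_count T s N)%:R / N%:R ^+ n.

Lemma lattice_density_le1 n (T : 'M[int]_n) s N : 0 <= lattice_density T s N <= 1.
Proof.
rewrite /lattice_density divr_ge0//= ?exprn_ge0//.
have [->|N0] := posnP N.
  case: n T s => [|n] T s; rewrite ?expr0 ?divr1 ?expr0n /= ?invr0 ?mulr0//.
  by rewrite -[leRHS]/(1%:R) ler_nat (leq_trans (max_card _))// card_ffun !card_ord.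
rewrite ler_pdivrMr ?exprn_gt0 ?ltr0n// mul1r -natrX ler_nat.
by rewrite (leq_trans (max_card _))// card_ffun !card_ord.
Qed.

Lemma lattice_density_refine n (T : 'M[int]_n) s : exists B : nat,
  forall A N, (linbound T s <= A)%N -> (0 < N)%N ->
  `|lattice_density T s (A * N) - lattice_density T s A| <= B%:R / A%:R.
Proof.
have [B HB] := boundary_card T s; exists B => A N CA N0.
have A0 : (0 < A)%N by apply: leq_trans CA.
have [] := lattice_count_refine CA N0; have := HB A.
rewrite /lattice_density; set b := #|_|; set x := lattice_count _ _ A.
set y := lattice_count _ _ _ => hb h1 h2.
have An : 0 < (A%:R : R) ^+ n by rewrite exprn_gt0 ?ltr0n.
have Nn : 0 < (N%:R : R) ^+ n by rewrite exprn_gt0 ?ltr0n.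
have bA : b%:R / A%:R ^+ n <= B%:R / A%:R :> R.
  rewrite ler_pdivrMr// mulrAC ler_pdivlMr ?ltr0n//.
  by rewrite -natrX -!natrM ler_nat mulnC.
apply: le_trans bA; rewrite natrM exprMn.
have -> : y%:R / (A%:R ^+ n * N%:R ^+ n) - x%:R / A%:R ^+ n =
  (y%:R - x%:R * N%:R ^+ n) / (A%:R ^+ n * N%:R ^+ n) :> R.
  by field; rewrite !gt_eqF// ltr0n.
rewrite normrM normfV [`|_ * _ ^+ _|]gtr0_norm ?mulr_gt0//.
rewrite ler_pdivrMr ?mulr_gt0// mulrA mulrVK ?unitfE ?gt_eqF//.
rewrite ler_norml; move: h1 h2.
rewrite -!(ler_nat R) !natrD !natrM !natrX.
by move: (x%:R * _) (b%:R * _) => u v; lra.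
Qed.

(* The densities at [A] and at [N] are both compared with the one at [A * N]. *)
Lemma lattice_density_cvg n (T : 'M[int]_n) s : cvgn (lattice_density T s).
Proof.
have [B HB] := lattice_density_refine T s.
apply: cvgn_unif_approx => e e0.
have [A /andP[AB AC]] : exists A : nat, ((B%:R / (e / 2) < A%:R)) && (linbound T s <= A)%N.
  exists (maxn (linbound T s) (Num.truncn (B%:R / (e/2))).+1).
  rewrite leq_maxl andbT (lt_le_trans (Num.Theory.truncnS_gt _))//.
  by rewrite ler_nat leq_maxr.
exists (fun=> lattice_density T s A); first exact: is_cvg_cst.
have small K : (A <= K)%N -> B%:R / K%:R <= e / 2.
  move=> AK; have K0 : (0 < K)%N by rewrite (leq_trans _ AK)// (leq_trans _ AC).
  rewrite ler_pdivrMr ?ltr0n// -ler_pdivrMl ?divr_gt0// mulrC.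
  by rewrite (le_trans (ltW AB))// ler_nat.
exists A => // N /= AN.
have A0 : (0 < A)%N by apply: leq_trans AC.
have := HB A N AC (leq_trans A0 AN); have := HB N A (leq_trans AC AN) A0.
rewrite mulnC => h1 h2; move: (small _ AN) (small _ (leqnn A)) => h3 h4.
have -> : lattice_density T s N - lattice_density T s A =
  (lattice_density T s (A * N) - lattice_density T s A) -
  (lattice_density T s (A * N) - lattice_density T s N) by ring.
rewrite (le_trans (ler_normB _ _))//; lra.
Qed.

End LatticeLimit.

(** * Sums over a cube grouped by the values of integer forms *)

Section WeightedLattice.
Variable R : realType.
Variables (n : nat) (M : {set 'I_n}) (U : 'M[int]_n).

Definition lin N (i : {ffun 'I_n -> 'I_N}) (k : 'I_n) : int :=
  \sum_f U k f * (i f)%:Z.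

Definition centered Q (e : {ffun 'I_n -> 'I_(Q.*2.+1)}) (k : 'I_n) : int :=
  (e k)%:Z - Q%:Z.

(** Two radii are kept apart: [Q] fixes the index type and [K] the cutoff, so that different cutoffs
    are compared term by term. Coordinates off [M] are pinned to 0 to represent each vector on [M]
    once. *)
Definition in_box Q K (e : {ffun 'I_n -> 'I_(Q.*2.+1)}) : bool :=
  [forall k, if k \in M then (`|centered e k| <= K)%N else centered e k == 0].

Definition box_sum (W : ('I_n -> int) -> R) Q K : R :=
  \sum_(e | in_box (Q := Q) K e) W (centered e).

Definition fibre_card N (e : 'I_n -> int) : nat :=
  #|[set i : {ffun 'I_n -> 'I_N} | [forall (k | k \in M), lin i k == e k]]|.

Lemma sum_lin_group (G : ('I_n -> int) -> R) N Q :
  (forall x y, (forall k, k \in M -> x k = y k) -> G x = G y) ->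
  \sum_(i : {ffun 'I_n -> 'I_N} | [forall (k | k \in M), `|lin i k| <= Q]%N) G (lin i) =
  \sum_(e | in_box (Q := Q) Q e) G (centered e) * (fibre_card N (centered e))%:R.
Proof.
move=> Gext.
pose enc (i : {ffun 'I_n -> 'I_N}) : {ffun 'I_n -> 'I_(Q.*2.+1)} :=
  [ffun k => if k \in M then inord `|(lin i k + Q%:Z)%R|%N else inord Q].
have encM i k : k \in M -> (`|lin i k| <= Q)%N -> centered (enc i) k = lin i k.
  by move=> kM iQ; rewrite /centered ffunE kM inordK; lia.
have encN i k : k \notin M -> centered (enc i) k = 0.
  by move=> kM; rewrite /centered ffunE (negbTE kM) inordK; lia.
rewrite (partition_big enc (in_box (Q := Q) Q)); last first.
  move=> i /forall_inP iQ; apply/forallP => k; case: ifPn => kM.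
    by rewrite encM// iQ.
  by rewrite encN.
apply: eq_bigr => e eQ; rewrite mulr_natr -sumr_const.
apply: eq_big => [i|i /andP[/forall_inP iQ /eqP <-]]; last first.
  by apply: Gext => k kM; rewrite encM// iQ.
rewrite inE; apply/andP/forall_inP => [[/forall_inP iQ /eqP <-] k kM|H].
  by rewrite encM// iQ.
have iQ k : k \in M -> (`|lin i k| <= Q)%N.
  move=> kM; rewrite (eqP (H _ kM)).
  by have /forallP/(_ k) := eQ; rewrite kM.
split; first by apply/forall_inP.
apply/eqP/ffunP => k; apply/val_inj.
have : centered (enc i) k = centered e k.
  have [kM|kM] := boolP (k \in M); first by rewrite encM ?iQ// (eqP (H _ kM)).
  rewrite encN//; have /forallP/(_ k) := eQ.
  by rewrite (negbTE kM) => /eqP ->.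
by rewrite /centered => /addIr [].
Qed.

(** When [lin i = e] on [M] is solved for [i], the columns of the inverse indexed by [M] meet
    prescribed values and go to [offset]. They are zeroed here rather than deleted, which keeps the
    matrix square. *)
Definition free_part : 'M[int]_n :=
  \matrix_(j, k) (if k \in M then 0 else invmx U j k).

Definition offset (e : 'I_n -> int) (j : 'I_n) : int :=
  \sum_(k in M) invmx U j k * e k.

Hypothesis U_unit : U \in unitmx.
Hypothesis U_free : forall f k, f \notin M -> U f k = (f == k)%:R.

(** Double count of the pairs [(i, y)] with [i] in the fibre and [y] equal to [i] off [M]. Each [i]
    has [N ^ #|M|] partners, the coordinates of [y] on [M] being idle; each [y] has one partner if
    the integral inverse of [U] sends it into the cube, and none otherwise. *)
Lemma fibre_card_lattice N e :
  (fibre_card N e * N ^ #|M|)%N = lattice_count free_part (offset e) N.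
Proof.
pose rel (i y : {ffun 'I_n -> 'I_N}) := [forall (k | k \in M), lin i k == e k] &&
  [forall (k | k \notin M), y k == i k].
have split_sum (w : 'I_n -> int) (y : {ffun 'I_n -> 'I_N}) j :
    (forall k, k \in M -> w k = e k) -> (forall k, k \notin M -> w k = (y k)%:Z) ->
    \sum_k invmx U j k * w k = linform free_part (offset e) y j.
  move=> wM wN; rewrite /linform /offset [RHS]addrC (bigID (mem M))/=; congr (_ + _).
    by apply: eq_bigr => k kM; rewrite wM.
  rewrite [RHS](bigID (mem M))/= [X in _ = X + _]big1 ?add0r; last first.
    by move=> k kM; rewrite mxE kM mul0r.
  by apply: eq_bigr => k kM; rewrite mxE (negbTE kM) wN.
have linK (i : {ffun 'I_n -> 'I_N}) j : \sum_k invmx U j k * lin i k = (i j)%:Z.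
  have := congr1 (fun A : 'cV[int]_n => A j 0) (mulKmx U_unit (\col_k (i k)%:Z)).
  rewrite !mxE => <-; apply: eq_bigr => k _; rewrite !mxE.
  by congr (_ * _); apply: eq_bigr => f _; rewrite mxE.
have linN (i : {ffun 'I_n -> 'I_N}) k : k \notin M -> lin i k = (i k)%:Z.
  move=> kM; rewrite /lin (bigD1 k)//= big1 ?addr0 => [|f fk].
    by rewrite U_free// eqxx mul1r.
  by rewrite U_free// eq_sym (negbTE fk) mul0r.
have relE i y : rel i y -> forall j, linform free_part (offset e) y j = (i j)%:Z.
  move=> /andP[/forall_inP iM /forall_inP iN] j.
  rewrite -(@split_sum (lin i)) ?linK// => k kM; first exact/eqP/iM.
  by rewrite linN// (eqP (iN _ kM)).
have card1 i : [forall (k | k \in M), lin i k == e k] ->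
    (\sum_(y | rel i y) 1 = N ^ #|M|)%N.
  move=> iM; transitivity (\sum_(y : {ffun 'I_n -> 'I_N})
      \prod_k ((k \in M) || (y k == i k)))%N.
    rewrite big_mkcond; apply: eq_bigr => y _; rewrite /rel iM /=.
    case: forallP => [H|/forallP H].
      rewrite big1// => k _; have := H k; rewrite implybE negbK => ->//.
    move: H; rewrite negb_forall => /existsP[k]; rewrite negb_imply => /andP[kM yk].
    by rewrite (bigD1 k)//= (negbTE kM) (negbTE yk) mul0n.
  rewrite -(bigA_distr_bigA (fun k v => ((k \in M) || (v == i k) : nat))).
  rewrite (bigID (mem M))/= [X in (_ * X)%N]big1 ?muln1; last first.
    move=> k kM; rewrite (bigD1 (i k))//= eqxx orbT big1// => v vk.
    by rewrite (negbTE kM) (negbTE vk).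
  under eq_bigr => k kM do (rewrite kM /=; rewrite sum1_card card_ord).
  by rewrite prod_nat_const.
have card2 y : (\sum_(i | rel i y) 1 = [forall j, in_range N (linform free_part (offset e) y j)])%N.
  case: forallP => [H|/forallP H]; last first.
    rewrite big1// => i riy; case/negP: H; apply/forallP => j.
    by rewrite (relE _ _ riy) /in_range lez_nat ltz_nat leq0n ltn_ord.
  pose w k := if k \in M then e k else (y k)%:Z.
  have Hlt j : (`|linform free_part (offset e) y j| < N)%N.
    by have := H j; rewrite /in_range; lia.
  pose i0 : {ffun 'I_n -> 'I_N} := [ffun j => Ordinal (Hlt j)].
  have i0E j : (i0 j)%:Z = linform free_part (offset e) y j.
    by rewrite ffunE /=; have := H j; rewrite /in_range; lia.
  have i0w j : (i0 j)%:Z = \sum_k invmx U j k * w k.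
    by rewrite i0E (@split_sum w y)// => k kM; rewrite /w ?kM ?(negbTE kM).
  have lin0 k : lin i0 k = w k.
    have := congr1 (fun A : 'cV[int]_n => A k 0) (mulKVmx U_unit (\col_k w k)).
    rewrite !mxE => <-; apply: eq_bigr => j _; rewrite i0w !mxE.
    by congr (_ * _); apply: eq_bigr => f _; rewrite mxE.
  have r0 : rel i0 y.
    apply/andP; split; apply/forall_inP => k kM; first by rewrite lin0 /w kM.
    by apply/eqP/val_inj/eqP; rewrite -eqz_nat -(linN i0 _ kM) lin0 /w (negbTE kM).
  rewrite (bigD1 i0)//= big1 ?addn0// => i /andP[riy /negP[]].
  apply/eqP/ffunP => j; apply/val_inj/eqP; rewrite -eqz_nat i0E.
  by rewrite (relE _ _ riy).
rewrite /lattice_count /fibre_card -sum_nat_const.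
rewrite (eq_bigr (fun i => \sum_(y | rel i y) 1)%N); last first.
  by move=> i; rewrite inE => iM; rewrite card1.
rewrite (eq_bigl (fun i => [forall (k | k \in M), lin i k == e k])); last first.
  by move=> i; rewrite inE.
rewrite (exchange_big_dep predT)//= -[RHS]sum1_card [RHS]big_mkcond /=.
apply: eq_bigr => y _; rewrite inE.
transitivity (\sum_(i | rel i y) 1)%N.
  by apply: eq_bigl => i; rewrite /rel andbA andbb.
by rewrite card2; case: ifP.
Qed.

End WeightedLattice.

Section SumLimit.
Local Open Scope classical_set_scope.
Variable R : realType.

Lemma cvg_sumr (I : Type) (r : seq I) (Q : pred I) (f : I -> nat -> R) (l : I -> R) :
  (forall i, Q i -> f i @ \oo --> l i) ->
  (fun N => \sum_(i <- r | Q i) f i N) @ \oo --> \sum_(i <- r | Q i) l i.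
Proof. by apply: cvg_big => //; exact: add_continuous. Qed.

End SumLimit.

(** * Dominated convergence for the grouped sums *)

Section WeightedLatticeLimit.
Local Open Scope classical_set_scope.
Variable R : realType.
Variables (n : nat) (M : {set 'I_n}) (U : 'M[int]_n).
Hypothesis U_unit : U \in unitmx.
Hypothesis U_free : forall f k, f \notin M -> U f k = (f == k)%:R.

Let dens (e : 'I_n -> int) (N : nat) : R :=
  lattice_density R (free_part M U) (offset M U e) N.

Lemma fibre_card_density N e : (0 < N)%N ->
  (fibre_card M U N e)%:R / N%:R ^+ (n - #|M|) = dens e N.
Proof.
move=> N0; rewrite /dens /lattice_density -(fibre_card_lattice U_unit U_free).
have Mn : (#|M| <= n)%N by rewrite (leq_trans (max_card _))// card_ord.
have -> : (N%:R : R) ^+ n = N%:R ^+ #|M| * N%:R ^+ (n - #|M|).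
  by rewrite -exprD subnKC.
rewrite natrM natrX; field.
by rewrite !expf_neq0// pnatr_eq0 -lt0n.
Qed.

Variable W : ('I_n -> int) -> R.
Hypothesis W_ge0 : forall x, 0 <= W x.
Hypothesis W_ext : forall x y, (forall k, k \in M -> x k = y k) -> W x = W y.
Variable S : nat -> R.
Hypothesis S_box : forall Q K, (K <= Q)%N -> box_sum M W Q K = S K.

Lemma box_sum_mono K Q : (K <= Q)%N -> S K <= S Q.
Proof.
move=> KQ; rewrite -(S_box KQ) -(S_box (leqnn Q)) /box_sum.
rewrite big_mkcond [leRHS]big_mkcond; apply: ler_sum => e _.
case: ifPn => [/forallP eK|_]; last by case: ifP.
rewrite ifT//; apply/forallP => k; have := eK k; case: ifP => // _ h.
exact: leq_trans h KQ.
Qed.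

(** A fibre density is at most 1, so the terms with a value outside the [K]-box cost at most the
    tail of [S], whatever [N] is. *)
Lemma weighted_lattice_cvg C : (forall K, S K <= C) ->
  cvgn (fun N => (\sum_(i : {ffun 'I_n -> 'I_N}) W (lin U i)) / N%:R ^+ (n - #|M|)).
Proof.
move=> SC; apply: cvgn_unif_approx => e e0.
have Scv : cvgn S.
  apply: nondecreasing_is_cvgn; first by move=> a b ab; exact: box_sum_mono.
  by exists C => _ [K _ <-].
have S_lim K : S K <= lim (S @ \oo).
  by apply: nondecreasing_cvgn_le => // a b ab; exact: box_sum_mono.
have [K SK] : exists K, lim (S @ \oo) - e <= S K.
  have /cvgrPdist_le/(_ _ e0) [K _ HK] := Scv.
  by exists K; have := HK K (leqnn K); rewrite ler_norml => /andP[]; lra.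
pose small N (i : {ffun 'I_n -> 'I_N}) := [forall (k | k \in M), `|lin U i k| <= K]%N.
have aK N : (0 < N)%N ->
    (\sum_(i : {ffun 'I_n -> 'I_N} | small N i) W (lin U i)) / N%:R ^+ (n - #|M|) =
    \sum_(f | in_box M (Q := K) K f) W (centered f) * dens (centered f) N.
  move=> N0; rewrite (sum_lin_group U _ _ W_ext) mulr_suml; apply: eq_bigr => f _.
  by rewrite -mulrA fibre_card_density.
exists (fun N => \sum_(f | in_box M (Q := K) K f) W (centered f) * dens (centered f) N).
  apply/cvg_ex; exists (\sum_(f | in_box M (Q := K) K f) W (centered f) * limn (dens (centered f))).
  apply: cvg_sumr => f _; apply: cvgMr; exact: lattice_density_cvg.
exists 1%N => // N /= N0; rewrite -aK// (bigID (small N))/= mulrDl addrAC subrr add0r.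
(* For fixed [N] finitely many [i] occur, so one [Q] bounds all their values and the tail becomes
   the finite difference [S Q - S K]. *)
have [Q KQ HQ] : exists2 Q, (K <= Q)%N & forall (i : {ffun 'I_n -> 'I_N}) k, (`|lin U i k| <= Q)%N.
  exists (maxn K (\max_(i : {ffun 'I_n -> 'I_N}) \max_k `|lin U i k|%N)).
    exact: leq_maxl.
  move=> i k; rewrite leq_max; apply/orP; right.
  apply: leq_trans (leq_bigmax i).
  exact: (leq_bigmax (F := fun k => `|lin U i k|%N)).
pose isK (x : 'I_n -> int) := [forall (k | k \in M), `|x k| <= K]%N.
pose G x := if isK x then 0 else W x.
have Gext x y : (forall k, k \in M -> x k = y k) -> G x = G y.
  move=> xy; rewrite /G (W_ext xy); congr (if _ then _ else _).
  by apply: eq_forallb_in => k kM; rewrite xy.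
have -> : \sum_(i | ~~ small N i) W (lin U i) =
    \sum_(i : {ffun 'I_n -> 'I_N} | [forall (k | k \in M), `|lin U i k| <= Q]%N) G (lin U i).
  rewrite [RHS](eq_bigl predT); last by move=> i; apply/forall_inP.
  by rewrite big_mkcond; apply: eq_bigr => i _; rewrite /G if_neg.
rewrite (sum_lin_group U _ _ Gext) mulr_suml.
have term f : G (centered f) * (fibre_card M U N (centered f))%:R / N%:R ^+ (n - #|M|)
   = G (centered f) * dens (centered f) N by rewrite -mulrA fibre_card_density.
under eq_bigr do rewrite term.
have G0 x : 0 <= G x by rewrite /G; case: ifP.
rewrite ger0_norm; last first.
  apply: sumr_ge0 => f _; rewrite mulr_ge0//.
  by case/andP: (lattice_density_le1 R (free_part M U) (offset M U (centered f)) N).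
apply: (@le_trans _ _ (S Q - S K)); last first.
  by have := S_lim Q; lra.
rewrite -(S_box KQ) -(S_box (leqnn Q)) lerBrDr /box_sum.
rewrite [X in _ + X <= _]big_mkcond [X in X + _ <= _]big_mkcond -big_split/= [leRHS]big_mkcond.
apply: ler_sum => f _.
have W0 := W_ge0 (centered f).
have Gd : G (centered f) * dens (centered f) N <= G (centered f).
  rewrite ler_piMr//.
  by case/andP: (lattice_density_le1 R (free_part M U) (offset M U (centered f)) N).
case: ifPn => fQ; case: ifPn => fK; rewrite ?addr0 ?add0r//.
- rewrite (_ : G _ = 0) ?mul0r ?add0r// /G ifT//.
  apply/forall_inP => k kM; have /forallP/(_ k) := fK; by rewrite kM.
- by rewrite (le_trans Gd)// /G; case: ifP.
- case/negP: fQ; apply/forallP => k; have /forallP/(_ k) := fK.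
  by case: ifP => // _ h; exact: leq_trans h KQ.
Qed.

End WeightedLatticeLimit.

(** * Finite sums under the integral *)

Section FiniteSums.
Local Open Scope classical_set_scope.
Context d (T : measurableType d) (R : realType).
Variables (mu : {measure set T -> \bar R}) (D : set T).
Hypothesis mD : measurable D.

Lemma integrable_sumr (I : Type) (r : seq I) (Q : pred I) (f : I -> T -> R) :
  (forall i, Q i -> mu.-integrable D (EFin \o f i)) ->
  mu.-integrable D (EFin \o (fun x => \sum_(i <- r | Q i) f i x)).
Proof.
move=> H; apply: eq_integrable (integrable_sum mD r H) => // x _ /=.
by rewrite sumEFin.
Qed.

Lemma integrable_mulrl (c : R) (f : T -> R) : mu.-integrable D (EFin \o f) ->
  mu.-integrable D (EFin \o (fun x => c * f x)).
Proof.
by move=> H; apply: eq_integrable (integrableZl mD c H).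
Qed.

Lemma integrable_addr (f g : T -> R) :
  mu.-integrable D (EFin \o f) -> mu.-integrable D (EFin \o g) ->
  mu.-integrable D (EFin \o (fun x => f x + g x)).
Proof. by move=> hf hg; apply: eq_integrable (integrableD mD hf hg). Qed.

Lemma integrable_subr (f g : T -> R) :
  mu.-integrable D (EFin \o f) -> mu.-integrable D (EFin \o g) ->
  mu.-integrable D (EFin \o (fun x => f x - g x)).
Proof. by move=> hf hg; apply: eq_integrable (integrableB mD hf hg). Qed.

Lemma integrable_normr (f : T -> R) :
  mu.-integrable D (EFin \o f) -> mu.-integrable D (EFin \o (fun x => `|f x|)).
Proof. by move=> /integrable_abse; apply: eq_integrable. Qed.

Lemma Rintegral_sum (I : Type) (r : seq I) (Q : pred I) (f : I -> T -> R) :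
  (forall i, Q i -> mu.-integrable D (EFin \o f i)) ->
  Rintegral mu D (fun x => \sum_(i <- r | Q i) f i x) =
  \sum_(i <- r | Q i) Rintegral mu D (f i).
Proof.
move=> H; elim: r => [|i r IH].
  under eq_Rintegral do rewrite big_nil.
  by rewrite big_nil Rintegral_cst// mul0r.
under eq_Rintegral do rewrite big_cons.
rewrite big_cons; case: ifPn => [Qi|_]; last exact: IH.
by rewrite RintegralD ?IH//; [exact: H|exact: integrable_sumr].
Qed.

End FiniteSums.

(** * Integrals of trigonometric functions over [[-pi, pi]] *)

Section Fourier.
Local Open Scope classical_set_scope.
Variable R : realType.
Notation mu := (@lebesgue_measure R).

Lemma measurable_Ipi : measurable (@Ipi R). Proof. exact: measurable_itv. Qed.
Hint Resolve measurable_Ipi : core.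

Lemma npi_lt_pi : - pi < pi :> R.
Proof. by rewrite (lt_trans _ (pi_gt0 R))// oppr_lt0 pi_gt0. Qed.

Lemma mu_Ipi : mu (@Ipi R) = (2 * pi)%:E.
Proof.
rewrite /Ipi lebesgue_measure_itv/= lte_fin npi_lt_pi -EFinD; congr _%:E; ring.
Qed.

Lemma continuous_bounded_Ipi (f : R -> R) : continuous f -> [bounded f x | x in @Ipi R].
Proof.
move=> cf; have cf' : {within (@Ipi R : set R^o), continuous (f : R^o -> R^o)}.
  exact: continuous_subspaceT.
have /compact_bounded[M [_ Mb]] := continuous_compact cf' (@segment_compact R _ _).
by exists M; split; rewrite ?num_real// => x xM y Iy; apply: (Mb x xM); exists y.
Qed.

Lemma continuous_integrable_Ipi (f : R -> R) : continuous f ->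
  mu.-integrable (@Ipi R) (EFin \o f).
Proof.
move=> cf; apply: measurable_bounded_integrable => //.
- by rewrite [X in (X < _)%E]mu_Ipi ltry.
- exact: measurable_funTS (continuous_measurable_fun cf).
- exact: continuous_bounded_Ipi.
Qed.

Lemma continuous_cosM (a : R) : continuous (fun x => cos (a * x)).
Proof.
move=> x; apply: (@continuous_comp _ _ _ (fun x => a * x) (@cos R)).
  exact: mulrl_continuous.
exact: continuous_cos.
Qed.

Lemma continuous_sinM (a : R) : continuous (fun x => sin (a * x)).
Proof.
move=> x; apply: (@continuous_comp _ _ _ (fun x => a * x) (@sin R)).
  exact: mulrl_continuous.
exact: continuous_sin.
Qed.

Lemma sin_int_pi (m : int) : sin (m%:~R * pi) = 0 :> R.
Proof.
have H (k : nat) : sin (k%:R * pi) = 0 :> R.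
  elim: k => [|k IH]; first by rewrite mul0r sin0.
  by rewrite -natr1 mulrDl mul1r sinDpi IH oppr0.
case: m => k; first exact: H.
by rewrite NegzE mulrNz mulNr sinN H oppr0.
Qed.

Lemma integral_cos_int (m : int) :
  Rintegral mu (@Ipi R) (fun x => cos (m%:~R * x)) = 2 * pi * (m == 0)%:R.
Proof.
have [->|m0] := eqVneq m 0.
  under eq_Rintegral do rewrite mul0r cos0.
  by rewrite Rintegral_cst// [X in fine X]mu_Ipi mul1r mulr1.
rewrite mulr0 /Rintegral /Ipi.
have m0' : (m%:~R : R) != 0 by rewrite intr_eq0.
pose F (x : R) := (m%:~R)^-1 * sin (m%:~R * x).
have dF (x : R) : is_derive x 1 F (cos (m%:~R * x)).
  have -> : cos (m%:~R * x) = m%:~R^-1 *: (m%:~R *: cos (m%:~R * x)).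
    by rewrite scalerA mulVf// scale1r.
  apply: is_deriveZ.
  have : is_derive x 1 (fun y : R => m%:~R * y : R) m%:~R.
    by rewrite -[X in is_derive _ _ _ X]mulr1; exact: is_deriveZ.
  move=> hd; have := @is_derive1_comp R (@sin R) (fun y : R => m%:~R * y : R) x _ _ _ hd.
  by move/(_ _ (is_derive_sin _)); rewrite mulrC.
rewrite (@continuous_FTC2 _ _ F)//.
- by rewrite /F mulrN sinN sin_int_pi oppr0 mulr0 sube0.
- exact: npi_lt_pi.
- exact/continuous_subspaceT/continuous_cosM.
- have cF : continuous F.
    by move=> x; apply/differentiable_continuous/derivable1_diffP; apply: ex_derive.
  split; first by move=> x _; apply: ex_derive.
  + by apply: cvg_at_right_filter; exact: cF.
  + by apply: cvg_at_left_filter; exact: cF.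
- by move=> x _; rewrite derive1E; apply: derive_val.
Qed.

End Fourier.

(** * Uniform moment bounds for Fourier partial sums *)

Section FourierBound.
Local Open Scope classical_set_scope.
Variable R : realType.
Notation mu := (@lebesgue_measure R).
Notation I := (@Ipi R).
Let mI : measurable I := @measurable_Ipi R.
Variable p : R -> R.
Hypothesis p_ge0 : forall x, I x -> 0 <= p x.
Hypothesis p_L : in_all_Lq p.
Hypothesis p_A : fourier_nonneg p.
Hypothesis p_mass : Rintegral mu I p = 1.

Lemma integrable_pX q : mu.-integrable I (EFin \o (fun x => p x ^+ q)).
Proof.
case: q => [|q].
  by apply: continuous_integrable_Ipi => x; exact: cvg_cst.
apply/integrableP; split.
  by apply/measurable_EFinP; apply: measurable_funX; case: p_L.
have [_ /(_ q.+1 isT)] := p_L; congr (_ < _)%E.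
by apply: eq_integral => x _ /=; rewrite normrX.
Qed.

Lemma integrable_pM (f : R -> R) q : continuous f ->
  mu.-integrable I (EFin \o (fun x => f x * p x ^+ q)).
Proof.
move=> cf; have := @integrableMr _ _ _ mu I mI f (EFin \o (fun x => p x ^+ q)).
apply => //; last exact: integrable_pX.
- exact: measurable_funTS (continuous_measurable_fun cf).
- exact: continuous_bounded_Ipi.
Qed.

Lemma integrable_pM1 (f : R -> R) : continuous f ->
  mu.-integrable I (EFin \o (fun x => f x * p x)).
Proof. exact: (@integrable_pM f 1). Qed.

Definition fcoef (m : int) : R := Rintegral mu I (fun x => cos (m%:~R * x) * p x).

Lemma fcoef_ge0 m : 0 <= fcoef m.
Proof. by case: (p_A m). Qed.

Lemma fcoefN m : fcoef (- m) = fcoef m.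
Proof. by apply: eq_Rintegral => x _; rewrite mulrNz mulNr cosN. Qed.

Lemma fcoef0 : fcoef 0 = 1.
Proof. by rewrite -p_mass; apply: eq_Rintegral => x _; rewrite mul0r cos0 mul1r. Qed.

Lemma a_nu_fcoef m : a_nu p m = (fcoef m)%:C.
Proof. by rewrite /a_nu (p_A m).1. Qed.

(** This is the partial sum [s] of the overview; the index [j = K] carries frequency 0. *)
Definition psum K (x : R) : R :=
  \sum_(j < K.*2.+1) fcoef (j%:Z - K%:Z) * cos ((j%:Z - K%:Z)%:~R * x).

Lemma continuous_sumr (J : Type) (r : seq J) (Q : pred J) (f : J -> R -> R) :
  (forall i, Q i -> continuous (f i)) -> continuous (fun x => \sum_(i <- r | Q i) f i x).
Proof. by move=> H; apply: continuous_big => //; exact: add_continuous. Qed.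

Lemma continuous_psumX K m : continuous (fun x => psum K x ^+ m).
Proof.
have cps : continuous (psum K).
  apply: continuous_sumr => i _ x; apply: cvgMr.
  exact: continuous_cosM.
by move=> x; apply: (@continuous_comp _ _ _ (psum K) (fun y => y ^+ m));
  [exact: cps|exact: exprn_continuous].
Qed.

Lemma expjD (x y : R) : expj (x + y) = expj x * expj y.
Proof. by rewrite /expj cosD sinD; apply/eqP; rewrite eq_complex /= !eqxx /= addrC. Qed.

Lemma expj0 : expj (0 : R) = 1.
Proof. by rewrite /expj cos0 sin0. Qed.

Lemma expj_sum (J : Type) (r : seq J) (Q : pred J) (f : J -> R) :
  expj (\sum_(i <- r | Q i) f i) = \prod_(i <- r | Q i) expj (f i).
Proof. by apply: (big_morph (@expj R)); [exact: expjD|exact: expj0]. Qed.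

Lemma sum_window (V : nmodType) (f : int -> V) Q K : (K <= Q)%N ->
  \sum_(j < Q.*2.+1 | (`|j%:Z - Q%:Z| <= K)%N) f (j%:Z - Q%:Z) =
  \sum_(j < K.*2.+1) f (j%:Z - K%:Z).
Proof.
move=> KQ.
rewrite (reindex_onto (fun j : 'I_K.*2.+1 => inord (j + (Q - K)) : 'I_Q.*2.+1)
  (fun j => inord (j - (Q - K)))); last first.
  move=> j jQ; apply/val_inj => /=.
  have := ltn_ord j; rewrite !inordK; lia.
apply: eq_big => j.
  rewrite inordK; last by have := ltn_ord j; lia.
  apply/andP; split; first by have := ltn_ord j; lia.
  by apply/eqP/val_inj => /=; rewrite addnK inordK.
by move=> _; congr f; rewrite inordK; have := ltn_ord j; lia.
Qed.

Lemma psum_expj K (x : R) :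
  \sum_(j < K.*2.+1) (fcoef (j%:Z - K%:Z))%:C * expj ((j%:Z - K%:Z)%:~R * x) =
  (psum K x)%:C.
Proof.
transitivity ((\sum_(j < K.*2.+1) fcoef (j%:Z - K%:Z) * cos ((j%:Z - K%:Z)%:~R * x)) +i*
   (\sum_(j < K.*2.+1) fcoef (j%:Z - K%:Z) * sin ((j%:Z - K%:Z)%:~R * x))).
  apply/eqP; rewrite eq_complex /= !raddf_sum /=; apply/andP; split; apply/eqP;
  by apply: eq_bigr => j _; rewrite /= mul0r ?subr0 ?addr0.
rewrite (_ : \sum_(j < K.*2.+1) _ * sin _ = 0)//.
set s := \sum_j _.
suff : s = - s by move=> /eqP; rewrite -addr_eq0 -mulr2n mulrn_eq0 => /eqP.
rewrite {1}/s (reindex_inj rev_ord_inj)/= -sumrN; apply: eq_bigr => j _.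
have -> : (K.*2.+1 - j.+1)%N%:Z - K%:Z = - (j%:Z - K%:Z) by have := ltn_ord j; lia.
by rewrite fcoefN mulrNz mulNr sinN mulrN.
Qed.

(** The power is expanded with [expj] in place of cosines, because a product of exponentials is a
    single exponential at the summed frequency; real parts are taken at the end. *)
Lemma psumX n (M : {set 'I_n}) Q K (x : R) : (K <= Q)%N ->
  psum K x ^+ #|M| = \sum_(e | in_box M (Q := Q) K e)
    (\prod_(k in M) fcoef (centered e k)) * cos ((\sum_(k in M) centered e k)%:~R * x).
Proof.
move=> KQ.
have E : (psum K x ^+ #|M|)%:C = \sum_(e | in_box M (Q := Q) K e)
    (\prod_(k in M) fcoef (centered e k))%:C * expj ((\sum_(k in M) centered e k)%:~R * x).
  rewrite rmorphXn /= -psum_expj.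
  rewrite -(sum_window (fun m => (fcoef m)%:C * expj (m%:~R * x)) KQ).
  rewrite -prodr_const (big_distr_big_dep (inord Q))/=.
  apply: eq_big => [e|e _]; last first.
    rewrite rmorph_prod big_split/=.
    congr (_ * _); rewrite -expj_sum; congr expj.
    by rewrite raddf_sum mulr_suml.
  apply/familyP/forallP => H k; have := H k; case: ifPn => kM //.
    by rewrite inE /centered => /eqP ->; rewrite inordK ?subrr//; lia.
  rewrite inE /centered subr_eq0 => /eqP [] eQ.
  by apply/eqP/val_inj; rewrite /= inordK//; lia.
have := congr1 (@complex.Re R) E; rewrite /= raddf_sum /= => ->.
by apply: eq_bigr => e _; rewrite /= mul0r subr0.
Qed.

Definition moment m K : R := Rintegral mu I (fun x => psum K x ^+ m * p x).

(** Integration against [p] turns each cosine into a coefficient at the summed frequency. By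
    evenness of [fcoef], this is the sum over values adding up to zero, with one value solved
    for. *)
Lemma momentE n (M : {set 'I_n}) Q K : (K <= Q)%N ->
  moment #|M| K = \sum_(e | in_box M (Q := Q) K e)
    (\prod_(k in M) fcoef (centered e k)) * fcoef (\sum_(k in M) centered e k).
Proof.
move=> KQ; rewrite /moment; under eq_Rintegral => x _.
  rewrite (psumX _ _ KQ) mulr_suml; under eq_bigr do rewrite -mulrA. over.
rewrite Rintegral_sum//; last first.
  by move=> e _; apply: integrable_mulrl => //; exact/integrable_pM1/continuous_cosM.
apply: eq_bigr => e _; rewrite RintegralZl//.
exact/integrable_pM1/continuous_cosM.
Qed.

(* Since [s^m] is a sum of cosines with nonnegative coefficients, inequalities
   between [int s^m g] need only be checked on one cosine. *)
Lemma psumX_cos m K : exists (J : finType) (w : J -> R) (v : J -> int),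
  (forall e, 0 <= w e) /\
  forall x, psum K x ^+ m = \sum_e w e * cos ((v e)%:~R * x).
Proof.
pose M := [set: 'I_m]%SET.
exists {ffun 'I_m -> 'I_K.*2.+1},
  (fun e => if in_box M (Q := K) K e then \prod_(k in M) fcoef (centered e k) else 0),
  (fun e => \sum_(k in M) centered e k); split=> [e|x].
  by case: ifP => // _; apply: prodr_ge0 => k _; exact: fcoef_ge0.
have := @psumX m M K K x (leqnn K); rewrite finset.cardsT card_ord => ->.
by rewrite big_mkcond/=; apply: eq_bigr => e _; case: ifP; rewrite ?mul0r.
Qed.

Lemma cosMcos (a b : int) (x : R) : cos (a%:~R * x) * cos (b%:~R * x) =
  2^-1 * cos ((a + b)%:~R * x) + 2^-1 * cos ((a - b)%:~R * x).
Proof. by rewrite intrB intrD !mulrDl mulNr cosD cosB; field. Qed.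

Lemma moment_le m K : moment m K <= moment m.+1 K.
Proof.
have [J [w [v [w0 E]]]] := psumX_cos m K.
have -> : moment m K = \sum_e w e * fcoef (v e).
  rewrite /moment; under eq_Rintegral => x _.
    rewrite E mulr_suml; under eq_bigr do rewrite -mulrA. over.
  rewrite Rintegral_sum//; last first.
    by move=> e _; apply: integrable_mulrl => //; exact/integrable_pM1/continuous_cosM.
  by apply: eq_bigr => e _; rewrite RintegralZl//; exact/integrable_pM1/continuous_cosM.
have -> : moment m.+1 K = \sum_e \sum_(j < K.*2.+1) w e * (fcoef (j%:Z - K%:Z) *
    (2^-1 * fcoef (v e + (j%:Z - K%:Z)) + 2^-1 * fcoef (v e - (j%:Z - K%:Z)))).
  rewrite /moment; transitivity (Rintegral mu I (fun x => \sum_e \sum_(j < K.*2.+1)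
     w e * (fcoef (j%:Z - K%:Z) * (2^-1 * (cos ((v e + (j%:Z - K%:Z))%:~R * x) * p x) +
       2^-1 * (cos ((v e - (j%:Z - K%:Z))%:~R * x) * p x))))).
    apply: eq_Rintegral => x _; rewrite exprSr E mulr_suml mulr_suml.
    apply: eq_bigr => e _; rewrite /psum mulr_sumr mulr_suml; apply: eq_bigr => j _.
    rewrite ![2^-1 * (_ * p x)]mulrA -[_ * p x + _]mulrDl -cosMcos; ring.
  have Ic (k : int) : mu.-integrable I (EFin \o (fun x => cos (k%:~R * x) * p x)).
    exact/integrable_pM1/continuous_cosM.
  have Id (k l : int) : mu.-integrable I (EFin \o (fun x =>
      2^-1 * (cos (k%:~R * x) * p x) + 2^-1 * (cos (l%:~R * x) * p x))).
    by apply: integrable_addr => //; exact: integrable_mulrl.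
  rewrite Rintegral_sum//; last first.
    move=> e _; apply: integrable_sumr => // j _.
    by do 2! apply: integrable_mulrl => //.
  apply: eq_bigr => e _; rewrite Rintegral_sum//; last first.
    by move=> j _; do 2! apply: integrable_mulrl => //.
  apply: eq_bigr => j _; rewrite RintegralZl//; last exact: integrable_mulrl.
  by rewrite RintegralZl// RintegralD// ?RintegralZl//; exact: integrable_mulrl.
apply: ler_sum => e _; rewrite -mulr_sumr ler_wpM2l//.
(* Of the extra factor only frequency 0 is kept: its coefficient is [fcoef 0 = 1] and it reproduces
   the lower moment, while all other terms are nonnegative. *)
have K2 : (K < K.*2.+1)%N by lia.
rewrite (bigD1 (Ordinal K2))//= subrr ?addr0 ?subr0 fcoef0 mul1r.
rewrite -mulrDl (_ : 2^-1 + 2^-1 = 1) ?mul1r; last by field.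
rewrite lerDl; apply: sumr_ge0 => j _.
by rewrite mulr_ge0 ?addr_ge0 ?mulr_ge0 ?fcoef_ge0 ?invr_ge0.
Qed.

(** Against a cosine of frequency [v], [s] integrates to [2 * pi * fcoef v] within the cutoff and to
    0 beyond it, whereas [2 * pi * p] always gives the full value. *)
Lemma psumX_moment m K :
  Rintegral mu I (fun x => psum K x ^+ m.+1) <= 2 * pi * moment m K.
Proof.
have [J [w [v [w0 E]]]] := psumX_cos m K.
have -> : moment m K = \sum_e w e * fcoef (v e).
  rewrite /moment; under eq_Rintegral => x _.
    rewrite E mulr_suml; under eq_bigr do rewrite -mulrA. over.
  rewrite Rintegral_sum//; last first.
    by move=> e _; apply: integrable_mulrl => //; exact/integrable_pM1/continuous_cosM.
  by apply: eq_bigr => e _; rewrite RintegralZl//; exact/integrable_pM1/continuous_cosM.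
have -> : Rintegral mu I (fun x => psum K x ^+ m.+1) = \sum_e \sum_(j < K.*2.+1)
    w e * (fcoef (j%:Z - K%:Z) * (pi * ((v e + (j%:Z - K%:Z)) == 0)%:R +
      pi * ((v e - (j%:Z - K%:Z)) == 0)%:R)).
  transitivity (Rintegral mu I (fun x => \sum_e \sum_(j < K.*2.+1)
     w e * (fcoef (j%:Z - K%:Z) * (2^-1 * cos ((v e + (j%:Z - K%:Z))%:~R * x) +
       2^-1 * cos ((v e - (j%:Z - K%:Z))%:~R * x))))).
    apply: eq_Rintegral => x _; rewrite exprSr E mulr_suml.
    apply: eq_bigr => e _; rewrite /psum mulr_sumr; apply: eq_bigr => j _.
    rewrite -cosMcos; ring.
  have Ic (k : int) : mu.-integrable I (EFin \o (fun x => cos (k%:~R * x))).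
    exact/continuous_integrable_Ipi/continuous_cosM.
  have Id (k l : int) : mu.-integrable I (EFin \o (fun x =>
      2^-1 * cos (k%:~R * x) + 2^-1 * cos (l%:~R * x))).
    by apply: integrable_addr => //; exact: integrable_mulrl.
  rewrite Rintegral_sum//; last first.
    move=> e _; apply: integrable_sumr => // j _.
    by do 2! apply: integrable_mulrl => //.
  apply: eq_bigr => e _; rewrite Rintegral_sum//; last first.
    by move=> j _; do 2! apply: integrable_mulrl => //.
  apply: eq_bigr => j _; rewrite RintegralZl//; last exact: integrable_mulrl.
  rewrite RintegralZl// RintegralD// ?RintegralZl//; try exact: integrable_mulrl.
  rewrite !integral_cos_int; congr (_ * (_ * _)).
  by field.
(* At most one index has frequency [u]. The bound serves for [u = v e] and [u = - v e], each with
   weight [pi]. *)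
have half (u : int) : \sum_(j < K.*2.+1) fcoef (j%:Z - K%:Z) * ((j%:Z - K%:Z) == u)%:R <= fcoef u.
  have [[j0 /eqP j0u]|nj] := pselect (exists j : 'I_K.*2.+1, j%:Z - K%:Z == u).
    rewrite (bigD1 j0)//= j0u eqxx mulr1 big1 ?addr0// => j jj0.
    rewrite (_ : _ == u = false) ?mulr0//; apply/negbTE/eqP => ju; move/eqP: jj0; apply.
    by apply/val_inj => /=; lia.
  rewrite big1 ?fcoef_ge0// => j _; rewrite (_ : _ == u = false) ?mulr0//.
  by apply/negbTE/negP => ju; apply: nj; exists j.
rewrite mulr_sumr; apply: ler_sum => e _.
rewrite -mulr_sumr mulrCA ler_wpM2l//.
under eq_bigr => j _ do rewrite mulrDr !(mulrCA _ pi).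
rewrite big_split/= -!mulr_sumr -mulrDr [2 * pi]mulrC -mulrA.
rewrite ler_wpM2l ?pi_ge0// mulr_natl mulr2n.
rewrite -{1}fcoefN lerD//; apply: le_trans (half _);
  apply: ler_sum => j _; rewrite ler_wpM2l ?fcoef_ge0// ler_nat.
  by rewrite addrC addr_eq0.
by rewrite subr_eq0 eq_sym.
Qed.

(** Split at [|x| = 2 * y]: below, [|x|] is replaced by [2 * y], whence the power of 2; above, [y]
    is replaced by [|x| / 2]. A factor below 1 before the even power is what permits absorption. *)
Lemma odd_power_young (k : nat) (x y : R) : 0 <= y ->
  x ^+ (k.*2.+1) * y <= 2^-1 * x ^+ (k.*2.+2) + 2 ^+ (k.*2.+1) * y ^+ (k.*2.+2).
Proof.
move=> y0.
have ev : x ^+ k.*2.+2 = `|x| ^+ k.*2.+2.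
  by rewrite -doubleS -mul2n !exprM real_normK// num_real.
have xl : x ^+ (k.*2.+1) * y <= `|x| ^+ (k.*2.+1) * y.
  by rewrite ler_wpM2r// (le_trans (ler_norm _))// normrX.
rewrite (le_trans xl)// ev.
have [xy|xy] := lerP `|x| (2 * y).
  rewrite (@le_trans _ _ (2 ^+ k.*2.+1 * y ^+ k.*2.+2))//.
    by rewrite [y ^+ k.*2.+2]exprSr mulrA -exprMn ler_wpM2r// ler_pXn2r// nnegrE mulr_ge0.
  by rewrite lerDr mulr_ge0 ?invr_ge0// exprn_ge0.
rewrite (@le_trans _ _ (2^-1 * `|x| ^+ k.*2.+2))//.
  rewrite [`|x| ^+ k.*2.+2]exprSr mulrCA ler_wpM2l ?exprn_ge0//.
  by rewrite -ler_pdivrMl ?invr_ge0// invrK ltW.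
by rewrite lerDl mulr_ge0// exprn_ge0.
Qed.

Lemma moment_odd_bounded k : exists C, forall K, moment k.*2.+1 K <= C.
Proof.
pose q := k.*2.+2.
pose Y := Rintegral mu I (fun x => (2 ^+ k.*2.+1 * (2 * pi) ^+ q) * p x ^+ q).
(* For [Z = 2 * pi * moment k.*2.+1 K], the Young inequality at [y = 2 * pi * p] and [psumX_moment]
   give [Z <= Z / 2 + Y], hence [Z <= 2 * Y]. *)
exists (2 * Y / (2 * pi)) => K.
have pi2 : 0 < 2 * pi :> R by rewrite mulr_gt0// pi_gt0.
have h1 := psumX_moment k.*2.+1 K.
have Is : mu.-integrable I (EFin \o (fun x => psum K x ^+ q)).
  exact/continuous_integrable_Ipi/continuous_psumX.
have IY : mu.-integrable I (EFin \o (fun x => (2 ^+ k.*2.+1 * (2 * pi) ^+ q) * p x ^+ q)).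
  exact: integrable_mulrl (integrable_pX q).
have h2 : 2 * pi * moment k.*2.+1 K <=
    2^-1 * Rintegral mu I (fun x => psum K x ^+ q) + Y.
  rewrite /moment -RintegralZl//; last exact/integrable_pM1/continuous_psumX.
  rewrite -RintegralZl// -RintegralD//; last exact: integrable_mulrl.
  apply: le_Rintegral => //.
  - by apply: integrable_mulrl => //; exact/integrable_pM1/continuous_psumX.
  - by apply: integrable_addr => //; exact: integrable_mulrl.
  move=> x Ix; have y0 : 0 <= 2 * pi * p x by rewrite mulr_ge0 ?p_ge0// ltW.
  have := odd_power_young k (psum K x) y0; rewrite exprMn.
  by congr (_ <= _); ring.
by rewrite ler_pdivlMr// mulrC; move: h1 h2; rewrite -/q; lra.
Qed.

Lemma moment_bounded m : exists C, forall K, moment m K <= C.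
Proof.
(* The exponent [m] lies below the odd exponent [m.*2.+1], and moments increase with the
   exponent. *)
have [C HC] := moment_odd_bounded m; exists C => K; apply: le_trans (HC K).
have mono (a b : nat) : (a <= b)%N -> moment a K <= moment b K.
  elim: b => [|b IH]; first by rewrite leqn0 => /eqP ->.
  by rewrite leq_eqVlt => /predU1P[->//|/IH h]; exact: le_trans h (moment_le _ _).
by apply: mono; lia.
Qed.

End FourierBound.

(** * Expectation of a product of functions of independent variables *)

Section Independence.
Local Open Scope classical_set_scope.
Variable R : realType.
Notation mu := (@lebesgue_measure R).
Notation I := (@Ipi R).
Let mI : measurable I := @measurable_Ipi R.

Lemma prod_norm_le1 (J : Type) (r : seq J) (x : J -> R) :
  (forall j, `|x j| <= 1) -> `|\prod_(j <- r) x j| <= 1.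
Proof.
move=> x1; rewrite normr_prod.
by elim: r => [|k r IH]; rewrite ?big_nil// big_cons mulr_ile1// prodr_ge0.
Qed.

Lemma prod_dist_le (J : Type) (r : seq J) (x y : J -> R) (e : R) :
  (forall j, `|x j| <= 1) -> (forall j, `|y j| <= 1) -> (forall j, `|x j - y j| <= e) ->
  `|\prod_(j <- r) x j - \prod_(j <- r) y j| <= e *+ size r.
Proof.
move=> x1 y1 xy; elim: r => [|j r IH]; first by rewrite !big_nil subrr normr0.
rewrite !big_cons /= mulrS.
have -> : x j * \prod_(k <- r) x k - y j * \prod_(k <- r) y k =
  (x j - y j) * \prod_(k <- r) x k +
  y j * (\prod_(k <- r) x k - \prod_(k <- r) y k) by ring.
rewrite (le_trans (ler_normD _ _))// !normrM lerD//.
  by apply: le_trans (xy j); rewrite ler_piMr// prod_norm_le1.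
by apply: le_trans IH; rewrite ler_piMl.
Qed.

(* Rounding down to multiples of [1 / m.+1]. The levels do not depend on [f], so that
   several functions can be quantised over the same index set. *)
Lemma quantise (m : nat) (f : R -> R) : measurable_fun setT f ->
  (forall x, `|f x| <= 1) ->
  let c (j : 'I_(m.+1).*2.+1) : R := (j%:R - m.+1%:R) / m.+1%:R in
  exists A : 'I_(m.+1).*2.+1 -> set R, (forall j, measurable (A j)) /\
    forall x, `|\sum_j c j * \1_(A j) x| <= 1 /\
              `|f x - \sum_j c j * \1_(A j) x| <= m.+1%:R^-1.
Proof.
move=> mf f1 c; set M := m.+1.
have M0 : 0 < M%:R :> R by rewrite ltr0n.
pose A (j : 'I_M.*2.+1) := f @^-1` `[c j, c j + M%:R^-1[%classic.
exists A; split=> [j|x].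
  by rewrite -[A j]setTI; apply: mf => //; exact: measurable_itv.
have fx := f1 x; move: fx; rewrite ler_norml => /andP[fx1 fx2].
pose z := Num.floor (M%:R * f x).
have /andP[z1 z2] : z%:~R <= M%:R * f x < (z + 1)%:~R by exact: floor_itv.
have zM : z <= M%:Z.
  rewrite -(ler_int R) (le_trans z1)// -[leRHS]mulr1 ler_wpM2l// ltW//.
have zMn : - M%:Z <= z.
  rewrite -ltzD1 -(ltr_int R) (le_lt_trans _ z2)//.
  by rewrite mulrNz -mulrN1 ler_wpM2l// ltW.
have hz : (`|(z + M%:Z)%R|%N < M.*2.+1)%N by lia.
have jE : ((`|(z + M%:Z)%R|%N)%:R : R) = z%:~R + M%:R.
  rewrite -[LHS]/((Posz _)%:~R) (_ : Posz _ = z + M%:Z); last by lia.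
  by rewrite intrD.
have cE : c (Ordinal hz) = z%:~R / M%:R by rewrite /c /= jE addrK.
have inA j : (\1_(A j) x : R) = (j == Ordinal hz)%:R.
  rewrite indicE; congr ((nat_of_bool _)%:R).
  apply/idP/eqP => [|->]; last first.
    rewrite inE /A /= in_itv/= cE ler_pdivrMr// mulrC z1/=.
    by rewrite -[X in _ + X]mul1r -mulrDl ltr_pdivlMr// mulrC -[1]/(1%:~R) -intrD.
  rewrite inE /A /= in_itv/= /c => /andP[h1 h2].
  apply/val_inj => /=.
  rewrite ler_pdivrMr// mulrC in h1.
  rewrite -[X in _ + X]mul1r -mulrDl ltr_pdivlMr// mulrC in h2.
  have h3 : (j%:Z - M%:Z)%:~R < (z + 1)%:~R :> R.
    by rewrite intrB; exact: le_lt_trans h1 z2.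
  have h4 : z%:~R < (j%:Z - M%:Z + 1)%:~R :> R.
    by rewrite intrD intrB; exact: le_lt_trans z1 h2.
  by rewrite !ltr_int in h3 h4; lia.
have -> : \sum_j c j * \1_(A j) x = z%:~R / M%:R.
  rewrite (bigD1 (Ordinal hz))//= inA eqxx mulr1 big1 ?addr0 ?cE// => j jz.
  by rewrite inA (negbTE jz) mulr0.
have w1 : z%:~R / M%:R <= f x by rewrite ler_pdivrMr// mulrC.
have w2 : f x < z%:~R / M%:R + M%:R^-1.
  by rewrite -[X in _ + X]mul1r -mulrDl ltr_pdivlMr// mulrC -[1]/(1%:~R) -intrD.
have w3 : -1 <= z%:~R / M%:R :> R.
  by rewrite ler_pdivlMr// mulN1r -[M%:R]/(M%:Z%:~R) -mulrNz ler_int.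
split; rewrite ler_norml; apply/andP; split => //.
- exact: le_trans w1 fx2.
- by rewrite (@le_trans _ _ 0)// ?subr_ge0// oppr_le0 invr_ge0 ltW.
- by rewrite lerBlDl ltW.
Qed.

Context dT (T : measurableType dT) (P : probability T R).
Variables (p : R -> R) (L : nat) (X : 'I_L -> T -> R).
Hypothesis p_ge0 : forall x, I x -> 0 <= p x.
Hypothesis p_int : mu.-integrable I (EFin \o p).
Hypothesis X_meas : forall l, measurable_fun setT (X l).
Hypothesis X_indep : mutually_independent P X.
Hypothesis X_law : forall l, has_density_on_pi P (X l) p.

Lemma mass_density : (0 < L)%N -> Rintegral mu I p = 1.
Proof.
case: L X X_law => [//|L'] X' X'_law _.
have := X'_law ord0 setT measurableT.
by rewrite preimage_setT probability_setT setTI /Rintegral => <-.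
Qed.

Lemma Rintegral_density_set l A : measurable A ->
  fine (P (X l @^-1` A)) = Rintegral mu I (fun x => \1_A x * p x).
Proof.
move=> mA; rewrite X_law// setIC -/(Rintegral mu (I `&` A) p) Rintegral_mkcondr.
by apply: eq_Rintegral => x _; rewrite patchE indicE; case: (x \in A); rewrite ?mul1r ?mul0r.
Qed.

Lemma bounded_integrable_P (f : T -> R) : measurable_fun setT f ->
  (forall w, `|f w| <= 1) -> P.-integrable setT (EFin \o f).
Proof.
move=> mf f1; apply: measurable_bounded_integrable => //.
  by rewrite [X in (X < _)%E]probability_setT ltry.
by exists 1; split=> // x x1 w _; exact: le_trans (f1 w) (ltW x1).
Qed.

Lemma bounded_integrable_p (f : R -> R) : measurable_fun setT f ->
  (forall x, `|f x| <= 1) -> mu.-integrable I (EFin \o (fun x => f x * p x)).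
Proof.
move=> mf f1; have := @integrableMr _ _ _ mu I mI f (EFin \o p).
apply => //; first exact: measurable_funTS.
by exists 1; split=> // x x1 w _; exact: le_trans (f1 w) (ltW x1).
Qed.

Lemma integrable_prod_comp (h : 'I_L -> R -> R) :
  (forall l, measurable_fun setT (h l)) -> (forall l x, `|h l x| <= 1) ->
  P.-integrable setT (EFin \o (fun w => \prod_l h l (X l w))).
Proof.
move=> mh h1; apply: bounded_integrable_P => [|w]; last exact: prod_norm_le1.
apply: measurable_prod => l _.
by apply: (measurableT_comp (mh l)); exact: X_meas.
Qed.

(** Distributing the product over the sums leaves indicators of intersections of preimages, the
    events that independence controls. *)
Lemma expect_prod_simple (J : finType) (c : J -> R) (A : 'I_L -> J -> set R) :
  (forall l j, measurable (A l j)) ->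
  Rintegral P setT (fun w => \prod_l \sum_j c j * \1_(A l j) (X l w)) =
  \prod_l Rintegral mu I (fun x => (\sum_j c j * \1_(A l j) x) * p x).
Proof.
move=> mA.
have mXA l j : measurable (X l @^-1` A l j).
  by rewrite -[_ @^-1` _]setTI; exact: X_meas.
have mcap (h : {ffun 'I_L -> J}) : measurable (\bigcap_(l in [set: 'I_L]) (X l @^-1` A l (h l))).
  by apply: fin_bigcap_measurable => // l _; exact: mXA.
have Iind (B : set T) : measurable B -> P.-integrable setT (EFin \o \1_B).
  by move=> mB; exact: integrable_indic.
transitivity (Rintegral P setT (fun w => \sum_(h : {ffun 'I_L -> J})
    (\prod_l c (h l)) * \1_(\bigcap_(l in [set: 'I_L]) (X l @^-1` A l (h l))) w)).
  apply: eq_Rintegral => w _; rewrite bigA_distr_bigA; apply: eq_bigr => h _.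
  rewrite big_split/=; congr (_ * _).
  have [[l nl]|all1] := pselect (exists l, ~ A l (h l) (X l w)).
    rewrite (bigD1 l)//= indicE memNset// mul0r indicE memNset//.
    by move=> /(_ l Logic.I).
  rewrite big1 => [|l _].
    rewrite indicE mem_set// => l _ /=.
    by apply: contrapT => nl; apply: all1; exists l.
  by rewrite indicE mem_set//; apply: contrapT => nl; apply: all1; exists l.
rewrite Rintegral_sum//; last first.
  by move=> h _; apply: integrable_mulrl => //; exact: Iind.
rewrite [RHS](eq_bigr (fun l => \sum_j c j * fine (P (X l @^-1` A l j)))); last first.
  move=> l _; have Ij j : mu.-integrable I (EFin \o (fun x => \1_(A l j) x * p x)).
    apply: bounded_integrable_p; first exact: measurable_indic.
    by move=> x; rewrite indicE; case: (_ \in _); rewrite ?normr1 ?normr0.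
  under eq_Rintegral => x _.
    rewrite mulr_suml; under eq_bigr do rewrite -mulrA. over.
  rewrite Rintegral_sum//; last by move=> j _; exact: integrable_mulrl.
  by apply: eq_bigr => j _; rewrite RintegralZl// Rintegral_density_set.
rewrite bigA_distr_bigA; apply: eq_bigr => h _.
rewrite RintegralZl//; last exact: Iind.
rewrite big_split/=; congr (_ * _).
rewrite /Rintegral integral_indic// setIT [X in fine X](X_indep (fun l => mA l (h l))).
rewrite (eq_bigr (fun l => (fine (P (X l @^-1` A l (h l))))%:E)) ?prodEFin// => l _.
by rewrite fineK// fin_num_measure.
Qed.

Lemma expect_prod (L0 : (0 < L)%N) (f : 'I_L -> R -> R) :
  (forall l, measurable_fun setT (f l)) -> (forall l x, `|f l x| <= 1) ->
  Rintegral P setT (fun w => \prod_l f l (X l w)) =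
  \prod_l Rintegral mu I (fun x => f l x * p x).
Proof.
move=> mf f1.
apply/eqP; rewrite -subr_eq0 -normr_le0.
apply/ler_addgt0Pl => e e0; rewrite addr0.
(* Replacing the [L] factors by simple functions costs [L / m.+1] in the expectation and again in
   the product of integrals, hence [L.*2]. *)
have [m me] : exists m : nat, m.+1%:R^-1 *+ L.*2 <= e.
  pose m := Num.truncn (L.*2%:R / e); exists m.
  rewrite -[_ *+ L.*2]mulr_natr mulrC ler_pdivrMr ?ltr0n// mulrC -ler_pdivrMr//.
  exact/ltW/truncnS_gt.
pose c (j : 'I_(m.+1).*2.+1) : R := (j%:R - m.+1%:R) / m.+1%:R.
have /choice[A HA] : forall l : 'I_L, exists A : 'I_(m.+1).*2.+1 -> set R,
    (forall j, measurable (A j)) /\ forall x,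
    `|\sum_j c j * \1_(A j) x| <= 1 /\
    `|f l x - \sum_j c j * \1_(A j) x| <= m.+1%:R^-1.
  by move=> l; exact: quantise.
pose g l x := \sum_j c j * \1_(A l j) x.
have mA l j : measurable (A l j) by case: (HA l).
have g1 l x : `|g l x| <= 1 by case: (HA l) => _ /(_ x) [].
have fg l x : `|f l x - g l x| <= m.+1%:R^-1 by case: (HA l) => _ /(_ x) [].
have mg l : measurable_fun setT (g l).
  apply: measurable_sum => j; apply: measurable_funM => //; exact: measurable_indic.
have Iprod := integrable_prod_comp.
have Igp (h : R -> R) := @bounded_integrable_p h.
have d1 : `|Rintegral P setT (fun w => \prod_l f l (X l w)) -
            Rintegral P setT (fun w => \prod_l g l (X l w))| <= m.+1%:R^-1 *+ L.
  rewrite -RintegralB//; [|exact: Iprod|exact: Iprod].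
  apply: le_trans (le_normr_Rintegral _ _) _ => //.
    by apply: integrable_subr => //; exact: Iprod.
  have -> : m.+1%:R^-1 *+ L = Rintegral P setT (fun=> m.+1%:R^-1 *+ L).
    by rewrite Rintegral_cst// [X in fine X]probability_setT mulr1.
  apply: le_Rintegral => //.
  - by apply: integrable_normr => //; apply: integrable_subr => //; exact: Iprod.
  - exact: finite_measure_integrable_cst.
  - move=> w _; have := @prod_dist_le _ (index_enum 'I_L) (fun l => f l (X l w))
      (fun l => g l (X l w)) m.+1%:R^-1.
    by rewrite /index_enum -enumT size_enum_ord; apply.
have pmass := mass_density L0.
have cst_p (a : R) : a = Rintegral mu I (fun x => a * p x).
  by rewrite RintegralZl// pmass mulr1.
have bound (h : R -> R) (a : R) : measurable_fun setT h -> (forall x, `|h x| <= 1) ->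
    (forall x, `|h x| <= a) -> `|Rintegral mu I (fun x => h x * p x)| <= a.
  move=> mh h1 ha; apply: le_trans (le_normr_Rintegral _ (Igp _ mh h1)) _ => //.
  rewrite [leRHS]cst_p; apply: le_Rintegral => //.
  - by apply: integrable_normr => //; exact: Igp.
  - exact: integrable_mulrl.
  - by move=> x Ix; rewrite normrM [`|p x|]ger0_norm ?p_ge0// ler_wpM2r ?p_ge0//.
have d2 : `|\prod_l Rintegral mu I (fun x => f l x * p x) -
            \prod_l Rintegral mu I (fun x => g l x * p x)| <= m.+1%:R^-1 *+ L.
  have := @prod_dist_le _ (index_enum 'I_L) (fun l => Rintegral mu I (fun x => f l x * p x))
      (fun l => Rintegral mu I (fun x => g l x * p x)) m.+1%:R^-1.
  rewrite /index_enum -enumT size_enum_ord; apply => l; try exact: bound.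
  rewrite -RintegralB//; [|exact: Igp|exact: Igp].
  apply: le_trans (le_normr_Rintegral _ _) _ => //.
    by apply: integrable_subr => //; exact: Igp.
  rewrite [leRHS]cst_p; apply: le_Rintegral => //.
  - by apply: integrable_normr => //; apply: integrable_subr => //; exact: Igp.
  - exact: integrable_mulrl.
  - by move=> x Ix; rewrite -mulrBl normrM [`|p x|]ger0_norm ?p_ge0// ler_wpM2r ?p_ge0//.
have eg : Rintegral P setT (fun w => \prod_l g l (X l w)) =
    \prod_l Rintegral mu I (fun x => g l x * p x) by exact: expect_prod_simple.
rewrite eg in d1; apply: le_trans me; rewrite -addnn mulrnDr.
apply: le_trans (lerD d1 d2).
rewrite [X in _ <= _ + X]distrC; apply: le_trans (ler_normD _ _).
by rewrite addrA subrK.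
Qed.

End Independence.

(** * Expectation of products of complex exponentials *)

Section CharacteristicFunctions.
Local Open Scope classical_set_scope.
Variable R : realType.
Notation mu := (@lebesgue_measure R).
Notation I := (@Ipi R).
Context dT (T : measurableType dT) (P : probability T R).

Definition cintegrable (Y : T -> R[i]) : Prop :=
  P.-integrable setT (EFin \o (fun w => complex.Re (Y w))) /\
  P.-integrable setT (EFin \o (fun w => complex.Im (Y w))).

Lemma cexpect_sum (J : finType) (c : J -> R[i]) (Y : J -> T -> R[i]) :
  (forall j, cintegrable (Y j)) ->
  cexpect P (fun w => \sum_j c j * Y j w) = \sum_j c j * cexpect P (Y j).
Proof.
move=> iY; apply/eqP; rewrite eq_complex /= !raddf_sum /=.
have ReM (a b : R[i]) : complex.Re (a * b) =
  complex.Re a * complex.Re b + (- complex.Im a) * complex.Im b.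
  by case: a b => [a1 a2] [b1 b2] /=; rewrite mulNr.
have ImM (a b : R[i]) : complex.Im (a * b) =
  complex.Re a * complex.Im b + complex.Im a * complex.Re b.
  by case: a b => [a1 a2] [b1 b2].
apply/andP; split; apply/eqP.
  transitivity (Rintegral P setT (fun w => \sum_j (complex.Re (c j) * complex.Re (Y j w) +
     (- complex.Im (c j)) * complex.Im (Y j w)))).
    by apply: eq_Rintegral => w _; rewrite raddf_sum; apply: eq_bigr => j _; exact: ReM.
  rewrite Rintegral_sum//; last first.
    by move=> j _; have [? ?] := iY j; apply: integrable_addr => //; exact: integrable_mulrl.
  apply: eq_bigr => j _; have [i1 i2] := iY j.
  by rewrite RintegralD ?RintegralZl ?ReM//; exact: integrable_mulrl.
transitivity (Rintegral P setT (fun w => \sum_j (complex.Re (c j) * complex.Im (Y j w) +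
     complex.Im (c j) * complex.Re (Y j w)))).
  by apply: eq_Rintegral => w _; rewrite raddf_sum; apply: eq_bigr => j _; exact: ImM.
rewrite Rintegral_sum//; last first.
  by move=> j _; have [? ?] := iY j; apply: integrable_addr => //; exact: integrable_mulrl.
apply: eq_bigr => j _; have [i1 i2] := iY j.
by rewrite RintegralD ?RintegralZl ?ImM//; exact: integrable_mulrl.
Qed.

Lemma cintegrable_sum (J : finType) (c : J -> R[i]) (Y : J -> T -> R[i]) :
  (forall j, cintegrable (Y j)) -> cintegrable (fun w => \sum_j c j * Y j w).
Proof.
move=> iY; split.
  apply: (@eq_integrable _ _ _ P setT measurableT (EFin \o (fun w =>
     \sum_j (complex.Re (c j) * complex.Re (Y j w) +
     (- complex.Im (c j)) * complex.Im (Y j w))))).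
    move=> w _ /=; apply: (congr1 EFin); rewrite raddf_sum; apply: eq_bigr => j _.
    by case: (c j) (Y j w) => [a1 a2] [b1 b2] /=; rewrite mulNr.
  apply: integrable_sumr => // j _; have [? ?] := iY j.
  by apply: integrable_addr => //; exact: integrable_mulrl.
apply: (@eq_integrable _ _ _ P setT measurableT (EFin \o (fun w =>
     \sum_j (complex.Re (c j) * complex.Im (Y j w) +
     complex.Im (c j) * complex.Re (Y j w))))).
  move=> w _ /=; apply: (congr1 EFin); rewrite raddf_sum; apply: eq_bigr => j _.
  by case: (c j) (Y j w) => [a1 a2] [b1 b2].
apply: integrable_sumr => // j _; have [? ?] := iY j.
by apply: integrable_addr => //; exact: integrable_mulrl.
Qed.

Lemma cexpect_real (f : T -> R) :
  cexpect P (fun w => (f w)%:C) = (Rintegral P setT f)%:C.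
Proof. by rewrite /cexpect /= Rintegral_cst// mul0r. Qed.

Variables (p : R -> R) (L : nat) (X : 'I_L -> T -> R).
Hypothesis p_ge0 : forall x, I x -> 0 <= p x.
Hypothesis p_int : mu.-integrable I (EFin \o p).
Hypothesis p_A : fourier_nonneg p.
Hypothesis X_meas : forall l, measurable_fun setT (X l).
Hypothesis X_indep : mutually_independent P X.
Hypothesis X_law : forall l, has_density_on_pi P (X l) p.

(** The Euler formula indexed by a boolean: a product of exponentials then distributes into products
    of bounded real functions, to which [expect_prod] applies. *)
Let cs (b : bool) (m : int) (x : R) : R := if b then sin (m%:~R * x) else cos (m%:~R * x).
Let u (b : bool) : R[i] := if b then 0 +i* 1 else 1.

Let expj_cs m x : expj (m%:~R * x) = \sum_b u b * (cs b m x)%:C.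
Proof.
rewrite big_bool /cs /u /= mul1r; apply/eqP; rewrite eq_complex /=.
by apply/andP; split; apply/eqP; ring.
Qed.

Let cs_meas b m : measurable_fun setT (cs b m).
Proof.
by case: b; apply: continuous_measurable_fun; [exact: continuous_sinM|exact: continuous_cosM].
Qed.

Let cs_le1 b m x : `|cs b m x| <= 1.
Proof.
by case: b; rewrite /cs ler_norml ?sin_geN1 ?sin_le1 ?cos_geN1 ?cos_le1.
Qed.

Let prod_expj (m : 'I_L -> int) w : \prod_l expj ((m l)%:~R * X l w) =
  \sum_(h : {ffun 'I_L -> bool}) (\prod_l u (h l)) * (\prod_l cs (h l) (m l) (X l w))%:C.
Proof.
under eq_bigr do rewrite expj_cs.
by rewrite bigA_distr_bigA; apply: eq_bigr => h _; rewrite big_split rmorph_prod.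
Qed.

Let cintegrable_prod_cs (m : 'I_L -> int) (h : {ffun 'I_L -> bool}) :
  cintegrable (fun w => (\prod_l cs (h l) (m l) (X l w))%:C).
Proof.
split; first by apply: (integrable_prod_comp P X_meas (h := fun l => cs (h l) (m l))).
exact: finite_measure_integrable_cst.
Qed.

Lemma cintegrable_prod_expj (m : 'I_L -> int) :
  cintegrable (fun w => \prod_l expj ((m l)%:~R * X l w)).
Proof.
have := cintegrable_sum (fun h : {ffun 'I_L -> bool} => \prod_l u (h l)) (cintegrable_prod_cs m).
by congr cintegrable; apply/funext => w; rewrite prod_expj.
Qed.

Lemma cexpect_prod_expj (L0 : (0 < L)%N) (m : 'I_L -> int) :
  cexpect P (fun w => \prod_l expj ((m l)%:~R * X l w)) = \prod_l (fcoef p (m l))%:C.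
Proof.
transitivity (cexpect P (fun w => \sum_(h : {ffun 'I_L -> bool})
    (\prod_l u (h l)) * (\prod_l cs (h l) (m l) (X l w))%:C)).
  by congr cexpect; apply/funext => w; exact: prod_expj.
rewrite cexpect_sum; last exact: cintegrable_prod_cs.
transitivity (\prod_l \sum_b u b * (Rintegral mu I (fun x => cs b (m l) x * p x))%:C).
  rewrite bigA_distr_bigA; apply: eq_bigr => h _.
  rewrite cexpect_real big_split/= -rmorph_prod.
  rewrite (expect_prod p_ge0 p_int X_meas X_indep X_law L0 (f := fun l => cs (h l) (m l)))//.
(* The sine part vanishes by [fourier_nonneg]. *)
apply: eq_bigr => l _; rewrite big_bool /u /cs (p_A (m l)).1 rmorph0 mulr0 mul1r /=.
exact: add0r.
Qed.

End CharacteristicFunctions.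

(** * The trace as a sum over column and row indices *)

Section TraceExpansion.
Variable R : realType.
Notation C := R[i].

(** The sum runs over paths from [x] to [y] with inner vertices [t]; at the last factor [nth y t r]
    is out of range, and its default supplies the endpoint. *)
Lemma foldr_mulmx_entry (A : comNzRingType) L m (B : 'I_m.+1 -> 'M[A]_L) x y :
  (foldr (fun r X => B r *m X) 1%:M (enum 'I_m.+1)) x y =
  \sum_(t : m.-tuple 'I_L) \prod_(r < m.+1) B r (nth y (x :: t) r) (nth y t r).
Proof.
elim: m B x => [|m IH] B x.
  rewrite enum_ordSl /= enum_ord0 /= mulmx1 (big_pred1 [tuple]) ?big_ord1// => t.
  by apply/esym/eqP; exact: tuple0.
rewrite enum_ordSl /= foldr_map mxE.
transitivity (\sum_(zt : 'I_L * m.-tuple 'I_L)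
   B ord0 x zt.1 * \prod_(r < m.+1) B (lift ord0 r) (nth y (zt.1 :: zt.2) r) (nth y zt.2 r)).
  rewrite -(pair_bigA _ (fun z (t : m.-tuple 'I_L) => B ord0 x z *
     \prod_(r < m.+1) B (lift ord0 r) (nth y (z :: t) r) (nth y t r)))/=.
  by apply: eq_bigr => z _; rewrite (IH (fun r => B (lift ord0 r))) mulr_sumr.
rewrite [RHS](reindex (fun zt : 'I_L * m.-tuple 'I_L => [tuple of zt.1 :: zt.2])); last first.
  exists (fun t => (thead t, [tuple of behead t])) => [[z t] _|t _]; last by rewrite -tuple_eta.
  by congr pair; apply/val_inj.
apply: eq_bigr => -[z t] _; rewrite [RHS]big_ord_recl /=; congr (_ * _).
Qed.

Lemma trace_foldr_mulmx (A : comNzRingType) L n (B : 'I_n.+1 -> 'M[A]_L) :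
  \tr (foldr (fun r X => B r *m X) 1%:M (enum 'I_n.+1)) =
  \sum_(l : {ffun 'I_n.+1 -> 'I_L}) \prod_r B r (l r) (l (ordS r)).
Proof.
rewrite /mxtrace; under eq_bigr do rewrite foldr_mulmx_entry.
rewrite pair_bigA /=.
pose F (xt : 'I_L * n.-tuple 'I_L) := [ffun r : 'I_n.+1 => nth xt.1 (xt.1 :: xt.2) r].
rewrite [RHS](reindex F); last first.
  apply: onW_bij; apply: inj_card_bij; last first.
    by rewrite card_prod card_tuple card_ffun !card_ord expnS.
  move=> [x t] [y s] /ffunP E.
  have xy : x = y by have := E ord0; rewrite !ffunE.
  congr pair => //; apply/val_inj/(@eq_from_nth _ x); rewrite ?size_tuple// => i ni.
  by have := E (lift ord0 (Ordinal ni)); rewrite !ffunE lift0 /= xy.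
apply: eq_bigr => -[x t] _; apply: eq_bigr => r _; rewrite !ffunE /=.
(* At [r = n] the successor wraps to 0 while [nth] returns its default [x]; this closes the
   cycle. *)
have := ltn_ord r; rewrite ltnS leq_eqVlt => /predU1P[rn|rn].
  by rewrite rn modnn /= [nth x t n]nth_default ?size_tuple.
by rewrite modn_small.
Qed.

Lemma conj_expj (x : R) : conjc (expj x) = expj (- x).
Proof. by rewrite /expj cosN sinN. Qed.

Lemma gram_entry N L (theta : 'I_L -> R) a b :
  (adjmx (vandermonde N theta) *m vandermonde N theta) a b =
  \sum_(k < N) (N%:R)^-1 * expj (k%:R * theta a - k%:R * theta b).
Proof.
rewrite mxE; apply: eq_bigr => k _; rewrite !mxE.
have conjM (u v : R[i]) : conjc (u * v) = conjc u * conjc v by rewrite rmorphM.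
rewrite conjM conj_expj opprK expjD.
rewrite mulrACA; congr (_ * _).
have -> : conjc (Num.sqrt (N%:R : R))^-1%:C = (Num.sqrt (N%:R : R))^-1%:C.
  by rewrite /conjc /= oppr0.
by rewrite -rmorphM /= -invfM -expr2 sqr_sqrtr ?ler0n// fmorphV rmorph_nat.
Qed.

(** The integer multiplying the phase of column [x]. Its sign is opposite to that of [E_block],
    which evenness makes harmless in [prod_freq]. *)
Definition freq n N L (l : {ffun 'I_n -> 'I_L}) (i : {ffun 'I_n -> 'I_N}) (x : 'I_L) : int :=
  \sum_(r | l r == x) ((i r)%:Z - (i (ord_pred r))%:Z).

Lemma trL_mixed_product n N L (d : 'I_n.+1 -> 'rV[C]_L) (theta : 'I_L -> R) :
  trL (mixed_product N d theta) =
  \sum_(li : {ffun 'I_n.+1 -> 'I_L} * {ffun 'I_n.+1 -> 'I_N})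
    ((L%:R)^-1 * (\prod_r d r 0 (li.1 r)) * (N%:R)^-1 ^+ n.+1) *
    \prod_x expj ((freq li.1 li.2 x)%:~R * theta x).
Proof.
rewrite /trL /mixed_product /=.
rewrite (trace_foldr_mulmx (fun r => diag_mx (d r) *m _)) mulr_sumr.
rewrite -(pair_bigA _ (fun (l : {ffun _ -> _}) (i : {ffun _ -> _}) =>
    ((L%:R)^-1 * (\prod_r d r 0 (l r)) * (N%:R)^-1 ^+ n.+1) *
    \prod_x expj ((freq l i x)%:~R * theta x)))/=.
apply: eq_bigr => l _; rewrite -mulr_sumr -!mulrA; congr (_ * _).
under eq_bigr do rewrite mul_diag_mx mxE gram_entry.
rewrite big_split/=; congr (_ * _).
rewrite bigA_distr_bigA mulr_sumr; apply: eq_bigr => i _.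
rewrite big_split/= prodr_const card_ord; congr (_ * _).
rewrite -expj_sum -expj_sum; congr expj.
(* Summation by parts around the cycle: the shift gathers [i r - i (ord_pred r)] in front of the
   phase of [l r]. *)
rewrite sumrB [X in _ - X](reindex_inj (can_inj (@ord_predK n.+1)))/=.
rewrite -sumrB (partition_big l predT)//=; apply: eq_bigr => x _.
rewrite /freq [in RHS]raddf_sum mulr_suml; apply: eq_bigr => r /eqP lr.
by rewrite ord_predK lr -mulrBl /= intrB.
Qed.

(** Fibres are taken over the image of [l] only, because a value that is not attained would add an
    empty block. *)
Definition ker_partition n L (l : {ffun 'I_n -> 'I_L}) : {set {set 'I_n}} :=
  [set l @^-1: [set x] | x in l @: [set: 'I_n]].

Lemma ker_partitionP n L (l : {ffun 'I_n -> 'I_L}) :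
  finset.partition (ker_partition l) [set: 'I_n].
Proof.
apply/and3P; split.
- rewrite finset.eqEsubset finset.subsetT; apply/fintype.subsetP => k _.
  apply/finset.bigcupP; exists (l @^-1: [set l k]); last by rewrite !inE.
  by apply: imset_f; apply: imset_f.
- apply/finset.trivIsetP => A B /imsetP[x _ ->] /imsetP[y _ ->] xy.
  rewrite -finset.setI_eq0; apply/eqP/finset.setP => k; rewrite !inE.
  apply/negP => /andP[/eqP kx /eqP ky]; case/eqP: xy; by rewrite -kx -ky.
- apply/negP => /imsetP[x /imsetP[k _ ->]] /finset.setP/(_ k).
  by rewrite !inE eqxx.
Qed.

(** Columns outside the image of [l] have frequency 0 and contribute [F 0 = 1]. *)
Lemma prod_freq (A : comPzRingType) n N L (l : {ffun 'I_n -> 'I_L})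
    (i : {ffun 'I_n -> 'I_N}) (F : int -> A) :
  F 0 = 1 -> (forall m, F (- m) = F m) ->
  \prod_x F (freq l i x) = \prod_(B in ker_partition l) F (E_block B i).
Proof.
move=> F0 FN; rewrite (bigID (mem (l @: [set: 'I_n])))/= [X in _ * X]big1 ?mulr1.
  rewrite [RHS]big_imset/=; last first.
    move=> x y /imsetP[k _ ->] _ /finset.setP/(_ k).
    by rewrite !inE eqxx => /esym/eqP.
  apply: eq_bigr => x _; rewrite -FN; congr F.
  rewrite /freq /E_block -sumrN; apply: eq_big => [r|r _]; first by rewrite !inE.
  by rewrite opprB.
move=> x nx; rewrite /freq big1 ?F0// => r /eqP lr.
by case/negP: nx; rewrite -lr; apply: imset_f.
Qed.

End TraceExpansion.

(** * Limits of complex sequences *)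

Section ComplexLimits.
Local Open Scope classical_set_scope.
Variable R : realType.
Notation C := R[i].

Lemma ccvg_cst (z : C) : ccvg (fun=> z) z.
Proof. by split; exact: cvg_cst. Qed.

Lemma ccvg_real (u : nat -> R) (x : R) : u @ \oo --> x -> ccvg (fun N => (u N)%:C) x%:C.
Proof. by move=> ux; split => //; exact: cvg_cst. Qed.

Lemma ccvgD (u v : nat -> C) y z : ccvg u y -> ccvg v z ->
  ccvg (fun N => u N + v N) (y + z).
Proof.
move=> [u1 u2] [v1 v2]; split; rewrite raddfD/=; under eq_fun do rewrite raddfD/=;
  exact: cvgD.
Qed.

Lemma ccvgM (u v : nat -> C) y z : ccvg u y -> ccvg v z ->
  ccvg (fun N => u N * v N) (y * z).
Proof.
have ReM (a b : C) : complex.Re (a * b) =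
  complex.Re a * complex.Re b - complex.Im a * complex.Im b by case: a b => [? ?] [? ?].
have ImM (a b : C) : complex.Im (a * b) =
  complex.Re a * complex.Im b + complex.Im a * complex.Re b by case: a b => [? ?] [? ?].
move=> [u1 u2] [v1 v2]; split.
  by rewrite ReM; under eq_fun do rewrite ReM; apply: cvgB; exact: cvgM.
by rewrite ImM; under eq_fun do rewrite ImM; apply: cvgD; exact: cvgM.
Qed.

Lemma ccvg_sum (J : Type) (r : seq J) (Q : pred J) (u : J -> nat -> C) (z : J -> C) :
  (forall j, Q j -> ccvg (u j) (z j)) ->
  ccvg (fun N => \sum_(j <- r | Q j) u j N) (\sum_(j <- r | Q j) z j).
Proof.
move=> H; elim: r => [|j r IH].
  by rewrite big_nil; under [X in ccvg X]eq_fun do rewrite big_nil; exact: ccvg_cst.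
rewrite big_cons; under [X in ccvg X]eq_fun do rewrite big_cons.
by case: ifP => // Qj; apply: ccvgD => //; exact: H.
Qed.

Lemma ccvg_prod (J : Type) (r : seq J) (Q : pred J) (u : J -> nat -> C) (z : J -> C) :
  (forall j, Q j -> ccvg (u j) (z j)) ->
  ccvg (fun N => \prod_(j <- r | Q j) u j N) (\prod_(j <- r | Q j) z j).
Proof.
move=> H; elim: r => [|j r IH].
  by rewrite big_nil; under [X in ccvg X]eq_fun do rewrite big_nil; exact: ccvg_cst.
rewrite big_cons; under [X in ccvg X]eq_fun do rewrite big_cons.
by case: ifP => // Qj; apply: ccvgM => //; exact: H.
Qed.

Lemma ccvg_eventually (u v : nat -> C) z :
  (forall N, (0 < N)%N -> v N = u N) -> ccvg u z -> ccvg v z.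
Proof.
move=> uv [u1 u2]; split.
  apply: cvg_trans u1; apply: near_eq_cvg; exists 1%N => // N /= N0.
  by rewrite uv.
apply: cvg_trans u2; apply: near_eq_cvg; exists 1%N => // N /= N0.
by rewrite uv.
Qed.

Lemma cvg_exprn (u : nat -> R) (x : R) k :
  u @ \oo --> x -> (fun N => u N ^+ k) @ \oo --> x ^+ k.
Proof.
move=> ux; elim: k => [|k IH]; first by under eq_fun do rewrite expr0; exact: cvg_cst.
by under eq_fun do rewrite exprS; rewrite exprS; exact: cvgM.
Qed.

Lemma cvg_invn_exp k : (0 < k)%N -> (fun N : nat => (N%:R : R)^-1 ^+ k) @ \oo --> (0 : R).
Proof.
have h : (fun N : nat => (N%:R : R)^-1) @ \oo --> (0 : R).
  by rewrite -(cvg_shiftS (fun N : nat => (N%:R : R)^-1)); exact: cvg_harmonic.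
by case: k => // k _; have := cvg_exprn (k := k.+1) h; rewrite expr0n.
Qed.

End ComplexLimits.

(** * Refinement of partitions and maps constant on blocks *)

Section PartitionSums.

Definition refines (T : finType) (rho sigma : {set {set T}}) : bool :=
  [forall (B | B \in rho), [exists (C | C \in sigma), B \subset C]].

Lemma refines_refl (T : finType) (rho : {set {set T}}) : refines rho rho.
Proof. by apply/forall_inP => B Br; apply/exists_inP; exists B. Qed.

Lemma partition_memP (T : finType) (rho : {set {set T}}) :
  finset.partition rho [set: T] ->
  forall k : T, finset.pblock rho k \in rho /\ k \in finset.pblock rho k.
Proof.
move=> /and3P[/eqP cov _ _] k.
have kc : k \in finset.cover rho by rewrite cov.
by rewrite pblock_mem// mem_pblock.
Qed.

Lemma partition_pblock (T : finType) (rho : {set {set T}}) B k :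
  finset.partition rho [set: T] -> B \in rho -> k \in B -> finset.pblock rho k = B.
Proof. by move=> /and3P[_ triv _]; exact: def_pblock. Qed.

(** Sending a block of [rho] to the block of [sigma] around it is onto; with equal cardinals it
    would be injective, no block of [sigma] would hold two blocks of [rho], and the partitions would
    coincide. *)
Lemma refines_card (T : finType) (rho sigma : {set {set T}}) :
  finset.partition rho [set: T] -> finset.partition sigma [set: T] ->
  refines rho sigma -> sigma != rho -> (#|sigma| < #|rho|)%N.
Proof.
move=> pr ps /forall_inP ref neq.
pose f (B : {set T}) := odflt finset.set0 [pick C in sigma | B \subset C].
have fP B : B \in rho -> f B \in sigma /\ B \subset f B.
  move=> /ref/exists_inP[C Cs BC]; rewrite /f; case: pickP => [D /andP[]//|/(_ C)].
  by rewrite Cs BC.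
have fpb C c : C \in sigma -> c \in C -> f (finset.pblock rho c) = C.
  move=> Cs cC; have [Br cB] := partition_memP pr c.
  have [fs /fintype.subsetP/(_ c cB) cf] := fP _ Br.
  by rewrite -(partition_pblock ps fs cf) (partition_pblock ps Cs cC).
have ne C : C \in sigma -> exists c, c \in C.
  move=> Cs; apply/finset.set0Pn; case/and3P: ps => _ _; apply: contra => /eqP <-//.
have sub : sigma \subset f @: rho.
  apply/fintype.subsetP => C Cs; have [c cC] := ne C Cs.
  by apply/imsetP; exists (finset.pblock rho c); [case: (partition_memP pr c)|rewrite (fpb C)].
have le1 := subset_leq_card sub; have le2 := leq_imset_card f (mem rho).
rewrite ltn_neqAle (leq_trans le1 le2) andbT; apply: contra neq => /eqP E.
have /imset_injP finj : #|f @: rho| == #|rho|.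
  by rewrite eqn_leq le2 -E.
rewrite eqEcard E leqnn andbT; apply/fintype.subsetP => C Cs; have [c cC] := ne C Cs.
have [Br cB] := partition_memP pr c.
suff -> : C = finset.pblock rho c by [].
apply/finset.setP => x; apply/idP/idP => [xC|xB]; last first.
  by have [_ /fintype.subsetP/(_ x xB)] := fP _ Br; rewrite (fpb C).
have [Br' xB'] := partition_memP pr x.
suff <- : finset.pblock rho x = finset.pblock rho c by [].
by apply: finj => //; rewrite !(fpb C).
Qed.

(** The condition on [l] says that it is constant on the blocks of [rho], hence comes from one map
    on blocks; expanding the right side sums over those maps. *)
Lemma sum_refines (A : comPzRingType) n L (rho : {set {set 'I_n}}) (F : 'I_n -> 'I_L -> A) :
  (0 < L)%N -> finset.partition rho [set: 'I_n] ->
  \sum_(l : {ffun 'I_n -> 'I_L} | refines rho (ker_partition l)) \prod_k F k (l k) =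
  \prod_(B in rho) \sum_x \prod_(k in B) F k x.
Proof.
move=> L0 pr; pose j0 := Ordinal L0.
rewrite (big_distr_big j0)/=.
pose Psi (h : {ffun {set 'I_n} -> 'I_L}) := [ffun k => h (finset.pblock rho k)].
(* Off [rho] the value is [j0], the default of the family over which [big_distr_big] expands. *)
pose Phi (l : {ffun 'I_n -> 'I_L}) : {ffun {set 'I_n} -> 'I_L} :=
  [ffun B : {set 'I_n} => if B \in rho then odflt j0 (omap l [pick k in B]) else j0].
rewrite [RHS](reindex_onto Phi Psi); last first.
  move=> h /familyP hP; apply/ffunP => B; rewrite !ffunE.
  case: ifPn => Br; last first.
    by have := hP B; rewrite (negbTE Br) inE => /eqP.
  case: pickP => [k kB|B0] /=; first by rewrite ffunE (partition_pblock pr Br kB).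
  case/and3P: pr => _ _ /negP[]; suff <- : B = finset.set0 by [].
  by apply/finset.setP => k; rewrite B0 inE.
have pick_block (B : {set 'I_n}) (k : 'I_n) : k \in B ->
    exists2 k', [pick k in B] = Some k' & k' \in B.
  by case: pickP => [k' k'B|->//]; exists k'.
symmetry; apply: eq_big => [l|l /andP[_ /eqP E]]; last first.
  symmetry; rewrite -[in LHS]E.
  case/and3P: (pr) => /eqP cov triv _.
  rewrite (eq_bigl (fun k => k \in finset.cover rho)); last by move=> k; rewrite cov inE.
  rewrite (finset.big_trivIset _ triv)/=; apply: eq_bigr => B Br; apply: eq_bigr => k kB.
  by rewrite [Psi _ _]ffunE (partition_pblock pr Br kB).
rewrite (_ : Phi l \in _ = true) /=; last first.
  by apply/familyP => B; rewrite ffunE; case: ifP.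
apply/eqP/forall_inP => [E B Br|ref]; last first.
  apply/ffunP => k; rewrite !ffunE; have [Br kB] := partition_memP pr k.
  rewrite Br; have [k' -> /= k'B] := pick_block _ _ kB.
  have /exists_inP[C /imsetP[x _ ->] /fintype.subsetP sub] := ref _ Br.
  by move: (sub _ kB) (sub _ k'B); rewrite !inE => /eqP -> /eqP ->.
have [k0 k0B] : exists k, k \in B.
  by apply/finset.set0Pn; case/and3P: pr => _ _; apply: contra => /eqP <-.
apply/exists_inP; exists (l @^-1: [set l k0]).
  by apply: imset_f; apply: imset_f.
have const k : k \in B -> l k = Phi l B.
  by move=> kB; rewrite -{1}E ffunE (partition_pblock pr Br kB).
by apply/fintype.subsetP => k kB; rewrite !inE !const.
Qed.

End PartitionSums.

(** * Limits of the diagonal sums with prescribed kernel *)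

Section DiagonalLimit.
Local Open Scope classical_set_scope.
Variable R : realType.
Notation C := R[i].

Lemma word_product_diag n L (d : 'I_n -> 'rV[C]_L) w :
  word_product d w = diag_mx (\row_x \prod_(k <- w) d k 0 x).
Proof.
elim: w => [|k w IH] /=.
  by apply/matrixP => x y; rewrite !mxE big_nil.
rewrite IH mulmx_diag; congr diag_mx; apply/rowP => x.
by rewrite !mxE big_cons.
Qed.

Lemma trL_word_product n L (d : 'I_n -> 'rV[C]_L) (B : {set 'I_n}) :
  trL (word_product d (enum B)) = (L%:R)^-1 * \sum_x \prod_(k in B) d k 0 x.
Proof.
rewrite /trL word_product_diag mxtrace_diag; congr (_ * _).
by apply: eq_bigr => x _; rewrite mxE big_enum.
Qed.

Variables (L : nat -> nat) (c : R).
Hypothesis L_pos : forall N, (0 < L N)%N.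
Hypothesis L_ratio : (fun N => (L N)%:R / N%:R : R) @ \oo --> c.
Variables (n : nat) (D : 'I_n.+1 -> forall N, 'rV[C]_(L N)) (Dl : seq 'I_n.+1 -> C).
Hypothesis D_joint : forall w, ccvg (fun N => trL (word_product (fun r => D r N) w)) (Dl w).

(** The powers of [N] and [L N] are those left in the expectation once [K_term] has taken its
    own. *)
Definition kernel_sum (rho : {set {set 'I_n.+1}}) (N : nat) : C :=
  (N%:R)^-1 ^+ (#|rho|.-1) * ((L N)%:R^-1 *
    \sum_(l : {ffun 'I_n.+1 -> 'I_(L N)} | ker_partition l == rho) \prod_r D r N 0 (l r)).

Lemma partition_card_gt0 (rho : {set {set 'I_n.+1}}) :
  finset.partition rho [set: 'I_n.+1]%SET -> (0 < #|rho|)%N.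
Proof.
move=> pr; apply/card_gt0P; exists (finset.pblock rho ord0).
by case: (partition_memP pr ord0).
Qed.

Lemma kernel_sum_cvg rho : finset.partition rho [set: 'I_n.+1]%SET ->
  ccvg (kernel_sum rho) ((c ^+ (#|rho|.-1))%:C * D_rho Dl rho).
Proof.
have [m] := ubnP #|rho|; elim: m rho => // m IH rho rm pr.
pose strict (sigma : {set {set 'I_n.+1}}) :=
  [&& finset.partition sigma [set: 'I_n.+1]%SET, refines rho sigma & sigma != rho].
have strict_card sigma : strict sigma -> (#|sigma| < #|rho|)%N.
  by case/and3P => ps ref ne; exact: refines_card.
(* [main] collects all maps constant on the blocks of [rho]: one of the [#|rho|] factors [L N] is
   cancelled by the trace normalisation, the others meet the powers of [N]. *)
pose main N : C := (((L N)%:R / N%:R : R) ^+ (#|rho|.-1))%:C *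
  \prod_(B in rho) trL (word_product (fun r => D r N) (enum B)).
(* Under the normalisation of [rho], a strictly coarser kernel keeps a positive power of [1 / N],
   which kills its convergent [kernel_sum]. *)
pose rest N : C := \sum_(sigma | strict sigma)
  (((N%:R : R)^-1 ^+ (#|rho| - #|sigma|))%:C * kernel_sum sigma N).
have main_cvg : ccvg main ((c ^+ (#|rho|.-1))%:C * D_rho Dl rho).
  apply: ccvgM; last by apply: ccvg_prod => B _; exact: D_joint.
  exact/ccvg_real/cvg_exprn.
have rest_cvg : ccvg (fun N => -1 * rest N) 0.
  rewrite -(mulr0 (-1)); apply: ccvgM; first exact: ccvg_cst.
  rewrite [X in ccvg _ X](_ : 0 = \sum_(sigma | strict sigma)
     ((0 : R)%:C * ((c ^+ (#|sigma|.-1))%:C * D_rho Dl sigma))); last first.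
    by rewrite big1// => sigma _; rewrite rmorph0 mul0r.
  apply: ccvg_sum => sigma st; apply: ccvgM.
    by apply/ccvg_real/cvg_invn_exp; rewrite subn_gt0; exact: strict_card.
  apply: IH; last by case/and3P: st.
  by have := strict_card _ st; move: rm; rewrite ltnS => h1 h2; exact: leq_trans h2 h1.
rewrite -[X in ccvg _ X]addr0.
apply: ccvg_eventually (ccvgD main_cvg rest_cvg) => N N0.
rewrite mulN1r; apply/eqP; rewrite eq_sym subr_eq; apply/eqP.
have N0' : (N%:R : C) != 0 by rewrite pnatr_eq0 -lt0n.
have L0' : ((L N)%:R : C) != 0 by rewrite pnatr_eq0 -lt0n.
have r0 := partition_card_gt0 pr.
have -> : main N = (N%:R)^-1 ^+ (#|rho|.-1) * ((L N)%:R^-1 *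
    \sum_(l : {ffun 'I_n.+1 -> 'I_(L N)} | refines rho (ker_partition l)) \prod_r D r N 0 (l r)).
  rewrite (sum_refines (fun k x => D k N 0 x) (L_pos N) pr) /main.
  under eq_bigr do rewrite trL_word_product.
  rewrite big_split/= prodr_const rmorphXn/= rmorphM/= fmorphV/= !rmorph_nat.
  set Pi := \prod_(B in rho) _; have -> : (L N)%:R^-1 ^+ #|rho| =
    (L N)%:R^-1 ^+ (#|rho|.-1) * (L N)%:R^-1 :> C by rewrite -exprSr prednK.
  rewrite exprMn !exprVn -!mulrA [LHS]mulrCA; congr (_ * _).
  by rewrite mulrA divff ?mul1r// expf_neq0.
rewrite (partition_big (fun l => ker_partition l)
  (fun sigma => finset.partition sigma [set: 'I_n.+1]%SET && refines rho sigma))/=; last first.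
  by move=> l ref; rewrite ker_partitionP.
rewrite (bigD1 rho)/=; last by rewrite pr refines_refl.
rewrite !mulrDr; congr (_ + _).
  rewrite /kernel_sum; congr (_ * (_ * _)); apply: eq_bigl => l.
  by case: eqP => [->|]; rewrite ?refines_refl ?andbF.
rewrite /rest !mulr_sumr; apply: eq_big => [sigma|sigma /andP[/andP[ps ref] ne]].
  by rewrite /strict andbA.
have st : strict sigma by rewrite /strict ps ref ne.
have sr := strict_card _ st; have s0 := partition_card_gt0 ps.
rewrite /kernel_sum [RHS]mulrA rmorphXn/= fmorphV/= rmorph_nat -exprD.
congr (_ ^+ _ * (_ * _)).
  by rewrite -subn1 -(subn1 #|sigma|) addnBA ?subnK //; apply: ltnW; exact: sr.
by apply: eq_bigl => l; case: eqP => [->|]; rewrite ?ref ?andbF.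
Qed.

End DiagonalLimit.

(** * Integer elimination of the block values along the cycle *)

Section BlockElimination.
Variables (n : nat) (rho : {set {set 'I_n.+1}}).
Hypothesis pr : finset.partition rho [set: 'I_n.+1].

Let blk (k : 'I_n.+1) : {set 'I_n.+1} := finset.pblock rho (ordS k).
Let B0 : {set 'I_n.+1} := finset.pblock rho ord0.

(* [i_k] is determined by [E_B] and the later coordinates when [k + 1] is the least
   element of a block [B] not containing 0; the other coordinates are free. *)
Definition determined : {set 'I_n.+1} :=
  [set k : 'I_n.+1 | (k.+1 < n.+1)%N &&
    [forall (l | l \in finset.pblock rho (ordS k)), k.+1 <= l]%N].

Definition elim_mx : 'M[int]_n.+1 := \matrix_(k, f)
  if k \in determined then
    \sum_(l in finset.pblock rho (ordS k)) ((f == ord_pred l)%:R - (f == l)%:R)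
  else (k == f)%:R.

Lemma elim_mx_free f k : f \notin determined -> elim_mx f k = (f == k)%:R.
Proof. by move=> fM; rewrite mxE (negbTE fM). Qed.

Lemma val_ord_pred (l : 'I_n.+1) : (0 < l)%N -> ord_pred l = l.-1 :> nat.
Proof.
move=> l0 /=; have := ltn_ord l => ln.
have -> : (l + n.+1).-1 = (l.-1 + n.+1)%N by lia.
by rewrite modnDr modn_small//; lia.
Qed.

Lemma val_ordS (k : 'I_n.+1) : (k.+1 < n.+1)%N -> ordS k = k.+1 :> nat.
Proof. by move=> kn /=; rewrite modn_small. Qed.

Lemma determinedP k : k \in determined ->
  (k.+1 < n.+1)%N /\ forall l, l \in finset.pblock rho (ordS k) -> (k.+1 <= l)%N.
Proof. by rewrite inE => /andP[-> /forall_inP H]. Qed.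

(** The matrix is triangular with unit diagonal: in a determined row [k], every element of the block
    is at least [k + 1], so no coordinate before [k] occurs and [k] itself comes only from
    [l = k + 1], with coefficient 1. *)
Lemma elim_mx_unit : elim_mx \in unitmx.
Proof.
rewrite -unitmx_tr unitmxE det_trig.
  rewrite big1 ?unitr1// => k _; rewrite !mxE; case: ifPn => [kM|_]; last by rewrite eqxx.
  have [kn lb] := determinedP kM.
  have [_ kB] := partition_memP pr (ordS k).
  rewrite (bigD1 (ordS k))//= ordSK eqxx big1 ?addr0 => [|l /andP[lB lk]].
    rewrite (_ : k == ordS k = false) ?subr0//.
    by apply/negbTE/eqP => /(congr1 val); rewrite /= modn_small//; lia.
  have kl := lb _ lB.
  rewrite (_ : k == l = false); last by apply/negbTE/eqP => kl'; rewrite -kl' ltnn in kl.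
  rewrite (_ : k == ord_pred l = false) ?subrr//; apply/negbTE/eqP => kl'.
  by case/eqP: lk; rewrite kl' ord_predK.
apply/is_trig_mxP => i j ij; rewrite !mxE; case: ifPn => [jM|_]; last first.
  by rewrite (_ : j == i = false)//; apply/negbTE/eqP => ji; rewrite ji ltnn in ij.
have [jn lb] := determinedP jM.
rewrite big1// => l /lb jl.
rewrite (_ : i == l = false); last by apply/negbTE/eqP => il; move: ij; rewrite il; lia.
rewrite (_ : i == ord_pred l = false) ?subrr//; apply/negbTE/eqP => /(congr1 val) il.
by move: ij; rewrite [X in (X < _)%N]il [X in (X < _)%N]val_ord_pred; lia.
Qed.

Lemma lin_elim_mx N (i : {ffun 'I_n.+1 -> 'I_N}) k : k \in determined ->
  lin elim_mx i k = E_block (finset.pblock rho (ordS k)) i.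
Proof.
move=> kM; rewrite /lin /E_block.
under eq_bigr do rewrite mxE kM mulr_suml.
rewrite exchange_big/=; apply: eq_bigr => l _.
have sum1 (j : 'I_n.+1) : \sum_f ((f == j)%:R : int) * (i f)%:Z = (i j)%:Z.
  rewrite (bigD1 j)//= eqxx mul1r big1 ?addr0// => f fj.
  by rewrite (negbTE fj) mul0r.
by under eq_bigr do rewrite mulrBl; rewrite sumrB !sum1.
Qed.

Let blk_inj : {in determined &, injective blk}.
Proof.
have le k k' : k \in determined -> k' \in determined -> blk k = blk k' -> (k <= k')%N.
  move=> /determinedP[kn lb] /determinedP[kn' _] E.
  have : ordS k' \in blk k by rewrite E; case: (partition_memP pr (ordS k')).
  by move/lb; rewrite [X in (_ <= X)%N]val_ordS.
move=> k k' kM kM' E; apply/val_inj/eqP; rewrite eqn_leq.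
by apply/andP; split; apply: le.
Qed.

(** A block without 0 is recovered from the predecessor of its least element. *)
Lemma blocks_determined : rho :\ B0 = blk @: determined.
Proof.
apply/finset.setP => B; rewrite !inE; apply/andP/imsetP => [[nB Br]|[k kM ->]]; last first.
  have [kn lb] := determinedP kM; split; last by case: (partition_memP pr (ordS k)).
  apply/eqP => E; have : ord0 \in blk k by rewrite E; case: (partition_memP pr ord0).
  by move/lb.
have [b0 b0B] : exists b, b \in B.
  by apply/finset.set0Pn; case/and3P: pr => _ _; apply: contra => /eqP <-.
case: (arg_minnP (fun k : 'I_n.+1 => k : nat) b0B) => m mB mmin.
have m0 : (0 < m)%N.
  rewrite lt0n; apply/eqP => m0; case/eqP: nB.
  rewrite -(partition_pblock pr Br mB) /B0; congr finset.pblock.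
  exact/val_inj.
have bE : blk (ord_pred m) = B by rewrite /blk ord_predK (partition_pblock pr Br mB).
exists (ord_pred m) => //; rewrite inE -/(blk _) bE val_ord_pred// prednK// ltn_ord/=.
by apply/forall_inP => l lB; exact: mmin.
Qed.

Lemma prod_blocks (A : comPzRingType) (F : {set 'I_n.+1} -> A) :
  \prod_(B in rho) F B = F B0 * \prod_(k in determined) F (finset.pblock rho (ordS k)).
Proof.
have [B0r _] := partition_memP pr ord0.
rewrite (bigD1 B0)//=; congr (_ * _).
rewrite -(big_imset _ blk_inj)/= -blocks_determined.
by apply: eq_bigl => B; rewrite !inE andbC.
Qed.

Lemma sum_blocks (A : zmodType) (F : {set 'I_n.+1} -> A) :
  \sum_(B in rho) F B = F B0 + \sum_(k in determined) F (finset.pblock rho (ordS k)).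
Proof.
have [B0r _] := partition_memP pr ord0.
rewrite (bigD1 B0)//=; congr (_ + _).
rewrite -(big_imset _ blk_inj)/= -blocks_determined.
by apply: eq_bigl => B; rewrite !inE andbC.
Qed.

Lemma card_determined : #|determined| = #|rho|.-1.
Proof.
have [B0r _] := partition_memP pr ord0.
by rewrite -(card_in_imset blk_inj) -blocks_determined [in RHS](cardsD1 B0) B0r.
Qed.

(** Over all blocks together the differences telescope around the cycle. *)
Lemma E_block_zero N (i : {ffun 'I_n.+1 -> 'I_N}) :
  E_block B0 i = - \sum_(k in determined) E_block (finset.pblock rho (ordS k)) i.
Proof.
apply/eqP; rewrite -addr_eq0 -(sum_blocks (fun B => E_block B i)).
case/and3P: pr => /eqP cov triv _.
rewrite -(finset.big_trivIset _ triv)/= cov.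
rewrite (eq_bigl predT); last by move=> k; rewrite inE.
by rewrite sumrB [X in _ - X](reindex_inj (can_inj (@ord_predK n.+1)))/= subrr.
Qed.

Lemma card_partition_le : (#|rho| <= n.+1)%N.
Proof.
have : (#|determined| <= n)%N.
  rewrite -ltnS -[X in (_ < X)%N](card_ord n.+1); apply: proper_card.
  apply/fintype.properP; split; first exact/fintype.subsetP.
  (* The successor of the last index wraps to 0, so that coordinate is always free. *)
  by exists ord_max => //; apply/negP => /determinedP[]; rewrite /= ltnn.
by rewrite card_determined; case: #|rho|.
Qed.

End BlockElimination.

(** * Existence of the expansion coefficients *)

Section ExpansionCoefficients.
Local Open Scope classical_set_scope.
Variable R : realType.
Notation C := R[i].
Notation mu := (@lebesgue_measure R).
Notation I := (@Ipi R).
Variable p : R -> R.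
Hypothesis p_ge0 : forall x, I x -> 0 <= p x.
Hypothesis p_L : in_all_Lq p.
Hypothesis p_A : fourier_nonneg p.
Hypothesis p_mass : Rintegral mu I p = 1.
Variables (n : nat) (rho : {set {set 'I_n.+1}}).
Hypothesis pr : finset.partition rho [set: 'I_n.+1]%SET.

Let M := determined rho.
Let W (x : 'I_n.+1 -> int) : R :=
  (\prod_(k in M) fcoef p (x k)) * fcoef p (\sum_(k in M) x k).

(** Evenness turns the factor of the dropped block into the coefficient at the sum of the other
    values, the shape found in [momentE]. *)
Lemma prod_fcoef_blocks N (i : {ffun 'I_n.+1 -> 'I_N}) :
  \prod_(B in rho) fcoef p (E_block B i) = W (lin (elim_mx rho) i).
Proof.
rewrite (prod_blocks pr) E_block_zero// fcoefN mulrC /W.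
congr (_ * _); first by apply: eq_bigr => k kM; rewrite lin_elim_mx.
by congr fcoef; apply: eq_bigr => k kM; rewrite lin_elim_mx.
Qed.

Definition K_seq N : R :=
  (\sum_(i : {ffun 'I_n.+1 -> 'I_N}) \prod_(B in rho) fcoef p (E_block B i)) /
  N%:R ^+ (n.+1 - #|rho|.-1).

Lemma K_seq_cvg : cvgn K_seq.
Proof.
have [c Hc] := moment_bounded p_ge0 p_L p_A p_mass #|M|.
have := @weighted_lattice_cvg R n.+1 M (elim_mx rho) (elim_mx_unit pr)
  (@elim_mx_free _ rho) W.
move=> /(_ _ _ (moment p #|M|) _ c Hc); rewrite card_determined//.
under eq_fun do under eq_bigr do rewrite -prod_fcoef_blocks.
apply.
- by move=> x; rewrite mulr_ge0 ?prodr_ge0// => *; exact: fcoef_ge0.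
- move=> x y xy; rewrite /W; congr (_ * _); first by apply: eq_bigr => k /xy ->.
  by congr fcoef; apply: eq_bigr => k /xy ->.
- by move=> Q K KQ; rewrite -(card_determined pr) (momentE p_L _ KQ).
Qed.

Lemma K_term_seq N : K_term p rho N = (K_seq N)%:C.
Proof.
have rn := card_partition_le pr.
have r0 := partition_card_gt0 pr.
rewrite /K_term /K_seq rmorphM/= mulrC; congr (_ * _).
  rewrite rmorph_sum/=; apply: eq_bigr => i _; rewrite rmorph_prod/=.
  by apply: eq_bigr => B _; rewrite a_nu_fcoef.
rewrite fmorphV rmorphXn/= rmorph_nat.
have -> : #|rho|%:Z - n.+1%:Z - 1 = - (n.+1 - #|rho|.-1)%N%:Z by lia.
by rewrite -exprnN.
Qed.

Lemma K_term_cvg : ccvg (K_term p rho) (limn K_seq)%:C.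
Proof.
rewrite (_ : K_term p rho = fun N => (K_seq N)%:C); last by apply/funext => N; exact: K_term_seq.
exact/ccvg_real/K_seq_cvg.
Qed.

End ExpansionCoefficients.

(** * The expected trace grouped by partitions *)

Section Expectation.
Local Open Scope classical_set_scope.
Variable R : realType.
Notation C := R[i].
Notation mu := (@lebesgue_measure R).
Notation I := (@Ipi R).
Context dT (T : measurableType dT) (P : probability T R).
Variables (p : R -> R) (n N L : nat) (d : 'I_n.+1 -> 'rV[C]_L) (X : 'I_L -> T -> R).
Hypothesis L_pos : (0 < L)%N.
Hypothesis N_pos : (0 < N)%N.
Hypothesis p_ge0 : forall x, I x -> 0 <= p x.
Hypothesis p_L : in_all_Lq p.
Hypothesis p_A : fourier_nonneg p.
Hypothesis X_meas : forall l, measurable_fun setT (X l).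
Hypothesis X_indep : mutually_independent P X.
Hypothesis X_law : forall l, has_density_on_pi P (X l) p.

Lemma expectation_partition :
  cexpect P (fun w => trL (mixed_product N d (fun l => X l w))) =
  \sum_(rho : {set {set 'I_n.+1}} | finset.partition rho [set: 'I_n.+1]%SET)
    K_term p rho N * ((N%:R)^-1 ^+ (#|rho|.-1) * (L%:R^-1 *
    \sum_(l : {ffun 'I_n.+1 -> 'I_L} | ker_partition l == rho) \prod_r d r 0 (l r))).
Proof.
have p_int : mu.-integrable I (EFin \o p) by exact: (integrable_pX p_L 1).
have p_mass : Rintegral mu I p = 1 by exact: mass_density X_law L_pos.
under [X in cexpect P X]eq_fun do rewrite trL_mixed_product.
rewrite cexpect_sum; last by move=> li; exact: (cintegrable_prod_expj P X_meas).
under eq_bigr do rewrite (cexpect_prod_expj p_ge0 p_int p_A X_meas X_indep X_law L_pos).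
rewrite -(pair_bigA _ (fun (l : {ffun 'I_n.+1 -> 'I_L}) (i : {ffun 'I_n.+1 -> 'I_N}) =>
   (L%:R)^-1 * (\prod_r d r 0 (l r)) * (N%:R)^-1 ^+ n.+1 *
   \prod_x (fcoef p (freq l i x))%:C))/=.
rewrite (partition_big (@ker_partition _ _)
  (fun rho => finset.partition rho [set: 'I_n.+1]%SET))/=; last first.
  by move=> l _; exact: ker_partitionP.
apply: eq_bigr => rho pr; rewrite !mulr_sumr; apply: eq_bigr => l /eqP kl.
rewrite -mulr_sumr.
have -> : \sum_(i : {ffun 'I_n.+1 -> 'I_N}) \prod_x (fcoef p (freq l i x))%:C =
    (\sum_(i : {ffun 'I_n.+1 -> 'I_N}) \prod_(B in rho) fcoef p (E_block B i))%:C.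
  rewrite rmorph_sum/=; apply: eq_bigr => i _.
  rewrite (prod_freq l i (F := fun m => (fcoef p m)%:C)) ?fcoef0 ?kl ?rmorph_prod//.
  by move=> m; rewrite fcoefN.
rewrite K_term_seq// /K_seq rmorphM/= fmorphV/= rmorphXn/= rmorph_nat.
have rn := card_partition_le pr.
have r0 := partition_card_gt0 pr.
have N0 : (N%:R : C) != 0 by rewrite pnatr_eq0 -lt0n.
(* The first power normalises the row sum into [K_term], the second goes with the column sum. *)
have -> : (N%:R : C)^-1 ^+ n.+1 = N%:R^-1 ^+ (n.+1 - #|rho|.-1) * N%:R^-1 ^+ #|rho|.-1.
  by rewrite -exprD subnK//; lia.
have reorder (A : comNzRingType) (x y a b s : A) :
  x * y * (a * b) * s = s * a * (b * (x * y)) by ring.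
by rewrite [in LHS]exprVn reorder.
Qed.

End Expectation.

Local Open Scope classical_set_scope.
Local Open Scope ring_scope.
Local Open Scope complex_scope.

Theorem theorem2 (R : realType)
  (* density p of the phase law nu on [-pi,pi], with p in \mathcal{L} \cap \mathcal{A} *)
  (p : R -> R)
  (p_ge0 : forall x, Ipi x -> 0 <= p x)
  (p_L : in_all_Lq p)
  (p_A : fourier_nonneg p)
  (* L = L(N) with L/N -> c *)
  (L : nat -> nat) (c : R)
  (L_pos : forall N, (0 < L N)%N)
  (L_ratio : (fun N => (L N)%:R / N%:R : R) @ \oo --> c)
  (* non-random diagonal L x L matrices D_1(N), ..., D_n(N) (given by their diagonals) *)
  (n : nat) (n_pos : (0 < n)%N)
  (D : 'I_n -> forall N : nat, 'rV[R[i]]_(L N))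
  (* joint limit distribution: D_{i_1,...,i_s} = lim_N tr_L(D_{i_1}(N) ... D_{i_s}(N)) *)
  (Dl : seq 'I_n -> R[i])
  (D_joint : forall w : seq 'I_n,
     ccvg (fun N => trL (word_product (fun r => D r N) w)) (Dl w))
  (* for each N, i.i.d. phases theta_1, ..., theta_L with law nu, on a probability space *)
  (dO : nat -> measure_display) (Omega : forall N, measurableType (dO N))
  (P : forall N, probability (Omega N) R)
  (theta : forall N, 'I_(L N) -> Omega N -> R)
  (theta_meas : forall N l, measurable_fun setT (theta N l))
  (theta_indep : forall N, mutually_independent (P N) (theta N))
  (theta_law : forall N l, has_density_on_pi (P N) (theta N l) p) :
  exists K : {set {set 'I_n}} -> R[i],
    (forall rho : {set {set 'I_n}}, finset.partition rho [set: 'I_n]%SET -> ccvg (K_term p rho) (K rho)) /\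
    ccvg (fun N => cexpect (P N)
            (fun w => trL (mixed_product N (fun r => D r N) (fun l => theta N l w))))
         (\sum_(rho : {set {set 'I_n}} | finset.partition rho [set: 'I_n]%SET)
             K rho * (c ^+ (#|rho|.-1))%:C * D_rho Dl rho).
Proof.
case: n n_pos D Dl D_joint => [//|m] _ D Dl D_joint.
(* Total mass 1 is read off the law of a single phase; index 0 will do because [L 0] is positive. *)
have p_mass := mass_density (theta_law 0%N) (L_pos 0%N).
exists (fun rho => (limn (K_seq p rho))%:C); split=> [rho pr|].
  exact: K_term_cvg.
(* The index [N = 0] is set aside because [expectation_partition] assumes [N] positive. *)
apply: (ccvg_eventually (u := fun N =>
    \sum_(rho : {set {set 'I_m.+1}} | finset.partition rho [set: 'I_m.+1]%SET)
      K_term p rho N * kernel_sum D rho N)) => [N N0|].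
  exact: expectation_partition.
apply: ccvg_sum => rho pr; rewrite -mulrA.
by apply: ccvgM; [exact: K_term_cvg|exact: kernel_sum_cvg].
Qed.
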